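(* Let $n\ge1$ be an integer and let $\mathcal H_{n,0}=\operatorname{Hom}(V_0,V_0^{\otimes(2n+1)})$, with the action of the braid group $\mathrm{Br}_{2n+1}$ by braiding. Then the representation of $\mathrm{Br}_{2n+1}$ on $\mathcal H_{n,0}$ is indefinite unitary: $\mathcal H_{n,0}$ carries a non-degenerate Hermitian form, of mixed signature (neither positive nor negative definite), that is preserved by $\mathrm{Br}_{2n+1}$. Furthermore, $\dim\mathcal H_{n,0}=\binom{2n}{n}$.
   Context: Put $q=e^{\pi i/2}$, $q^x=e^{\pi i x/2}$, $\{x\}=q^x-q^{-x}$. The unrolled quantum group is the Hopf algebra over $\mathbb C$ generated by $E,F,K^{\pm1},H$ with relations $KEK^{-1}=q^2E$, $KFK^{-1}=q^{-2}F$, $[E,F]=\frac{K-K^{-1}}{q-q^{-1}}$, $HK=KH$, $[H,E]=2E$, $[H,F]=-2F$, $E^2=F^2=0$, and coproduct $\Delta(E)=1\otimes E+E\otimes K$, $\Delta(F)=K^{-1}\otimes F+F\otimes 1$, $\Delta(K)=K\otimes K$, $\Delta(H)=H\otimes1+1\otimes H$. One works in the category of finite-dimensional modules on which $H$ is diagonalizable and $K=q^H$; $\operatorname{Hom}$ means module homomorphisms. $V_0$ is the module with basis $v_0,v_1$ and $Hv_0=v_0$, $Hv_1=-v_1$, $Ev_0=0$, $Ev_1=v_0$, $Fv_0=v_1$, $Fv_1=0$. The braiding is $c_{V,W}=\tau\circ R:V\otimes W\to W\otimes V$, where $R=q^{H\otimes H/2}(1+\{1\}E\otimes F)$, $q^{H\otimes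 H/2}$ multiplies a tensor of weight vectors of weights $\lambda,\lambda'$ by $q^{\lambda\lambda'/2}$, and $\tau$ is the flip. The generator $\sigma_i$ of the braid group $\mathrm{Br}_{2n+1}$ on $2n+1$ strands acts on $\mathcal H_{n,0}$ by post-composition with $c_{V_0,V_0}$ in tensor positions $i,i+1$. *)

(* Defs.v *)
(* The ground field is C = R[i], for an arbitrary R : realType (a complete
   archimedean ordered field, hence a copy of the real numbers). *)
From HB Require Import structures.
From mathcomp Require Import all_boot all_order all_algebra.
From mathcomp Require Import boolp classical_sets reals sequences exp trigo.
From mathcomp Require Import complex mxtens.
From mathcomp Require Import ring.

Set Implicit Arguments.
Unset Strict Implicit.
Unset Printing Implicit Defensive.

Import Order.TTheory GRing.Theory Num.Theory.

Local Open Scope ring_scope.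
Local Open Scope complex_scope.

Section QuantumPowers.
Variable R : realType.

Definition cexp (z : R[i]) : R[i] :=
  (expR (complex.Re z))%:C *
  (cos (complex.Im z) +i* sin (complex.Im z)).

(* q^x = e^(pi i x / 2), for x an arbitrary complex number *)
Definition qpow (x : R[i]) : R[i] := cexp ((pi%:C * 'i) * x / 2%:R).

Definition qq : R[i] := qpow 1.

(* {x} = q^x - q^-x *)
Definition qbrace (x : R[i]) : R[i] := qpow x - qpow (- x).

Lemma cexpD (x y : R[i]) : cexp (x + y) = cexp x * cexp y.
Proof.
case: x y => [a b] [c d]; rewrite /cexp /= expRD cosD sinD.
by apply/eqP; rewrite eq_complex /=; apply/andP; split; apply/eqP; ring.
Qed.

Lemma cexp0 : cexp (0 : R[i]) = 1.
Proof.
rewrite /cexp /= expR0 cos0 sin0; apply/eqP; rewrite eq_complex /=.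
by apply/andP; split; apply/eqP; ring.
Qed.

Lemma qpowD (x y : R[i]) : qpow (x + y) = qpow x * qpow y.
Proof. by rewrite /qpow mulrDr mulrDl cexpD. Qed.

Lemma qpow0 : qpow (0 : R[i]) = 1.
Proof. by rewrite /qpow mulr0 mul0r cexp0. Qed.

Lemma qpow_unit (x : R[i]) : qpow x \is a GRing.unit.
Proof.
apply/unitrP; exists (qpow (- x)).
by rewrite -!qpowD addNr subrr qpow0.
Qed.

Lemma qqE : qq = 'i :> R[i].
Proof.
have e : (pi%:C * 'i) * 1 / 2%:R = 0 +i* (pi / 2%:R) :> R[i].
  apply: (@mulIf _ 2%:R); first by rewrite pnatr_eq0.
  rewrite divfK ?pnatr_eq0 // mulr1; apply/eqP; rewrite eq_complex /=.
  by apply/andP; split; apply/eqP; field.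
rewrite /qq /qpow e /cexp /= expR0 cos_pihalf sin_pihalf.
by apply/eqP; rewrite eq_complex /=; apply/andP; split; apply/eqP; ring.
Qed.

Lemma qpow2 : qpow (2%:R : R[i]) = -1.
Proof.
rewrite -[2%:R]/(1 + 1 : R[i]) qpowD -/qq qqE.
by apply/eqP; rewrite eq_complex /=; apply/andP; split; apply/eqP; ring.
Qed.

Lemma qpowN1 : qpow (- 1 : R[i]) = - 'i.
Proof.
apply: (mulIr (qpow_unit 1)); rewrite -qpowD addNr qpow0 -/qq qqE.
by apply/eqP; rewrite eq_complex /=; apply/andP; split; apply/eqP; ring.
Qed.

End QuantumPowers.

(* Modules are given in coordinates: the underlying space is C^udim, written as
   columns, and the generators act by left multiplication.  K^-1 acts as the
   inverse of K.  The last two axioms are the category's: H is diagonalizable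
   and K = q^H. *)
Record umodule (R : realType) := UModule {
  udim : nat;
  uE : 'M[R[i]]_udim;
  uF : 'M[R[i]]_udim;
  uK : 'M[R[i]]_udim;
  uH : 'M[R[i]]_udim;
  uK_unit : uK \in unitmx;
  uKE : uK *m uE *m invmx uK = qpow 2%:R *: uE;
  uKF : uK *m uF *m invmx uK = qpow (- 2%:R) *: uF;
  uEF : uE *m uF - uF *m uE = (qq R - (qq R)^-1)^-1 *: (uK - invmx uK);
  uHK : uH *m uK = uK *m uH;
  uHE : uH *m uE - uE *m uH = 2%:R *: uE;
  uHF : uH *m uF - uF *m uH = - 2%:R *: uF;
  uE2 : uE *m uE = 0;
  uF2 : uF *m uF = 0;
  uH_diag : diagonalizable uH;
  uK_qH : forall (l : R[i]) (v : 'cV[R[i]]_udim),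
    uH *m v = l *: v -> uK *m v = qpow l *: v
}.

Section Tensor.
Variable R : realType.
Local Notation C := R[i].

Lemma tensmx11 m n : (1%:M : 'M[C]_m) *t (1%:M : 'M[C]_n) = 1%:M.
Proof.
apply/matrixP => i j; case: (mxtens_indexP i) => i0 i1.
case: (mxtens_indexP j) => j0 j1; rewrite tensmxE !mxE -natrM mulnb.
congr (nat_of_bool _)%:R; apply/andP/eqP => [[/eqP-> /eqP->] //|].
by move=> /(can_inj (@mxtens_indexK _ _))[-> ->].
Qed.

Lemma tensmx_unit' m n (A : 'M[C]_m) (B : 'M[C]_n) :
  A \in unitmx -> B \in unitmx -> (A *t B) \in unitmx.
Proof.
move=> uA uB; have /mulmx1_unit[] // : (A *t B) *m (invmx A *t invmx B) = 1%:M.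
by rewrite tensmx_mul !mulmxV // tensmx11.
Qed.

Lemma invmx_tens m n (A : 'M[C]_m) (B : 'M[C]_n) :
  A \in unitmx -> B \in unitmx -> invmx (A *t B) = invmx A *t invmx B.
Proof.
move=> uA uB; have uAB := tensmx_unit' uA uB.
by rewrite -[RHS](mulKmx uAB) tensmx_mul !mulmxV // tensmx11 mulmx1.
Qed.

Lemma tensmxDl m n p q (A B : 'M[C]_(m, n)) (D : 'M[C]_(p, q)) :
  (A + B) *t D = A *t D + B *t D.
Proof. by apply/matrixP => i j; rewrite !mxE mulrDl. Qed.

Lemma tensmxDr m n p q (A : 'M[C]_(m, n)) (B D : 'M[C]_(p, q)) :
  A *t (B + D) = A *t B + A *t D.
Proof. by apply/matrixP => i j; rewrite !mxE mulrDr. Qed.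

Lemma tensmxZl m n p q a (A : 'M[C]_(m, n)) (B : 'M[C]_(p, q)) :
  (a *: A) *t B = a *: (A *t B).
Proof. by apply/matrixP => i j; rewrite !mxE mulrA. Qed.

Lemma tensmxZr m n p q a (A : 'M[C]_(m, n)) (B : 'M[C]_(p, q)) :
  A *t (a *: B) = a *: (A *t B).
Proof. by apply/matrixP => i j; rewrite !mxE mulrCA. Qed.

Lemma tensmxNl m n p q (A : 'M[C]_(m, n)) (B : 'M[C]_(p, q)) :
  (- A) *t B = - (A *t B).
Proof. by rewrite -scaleN1r tensmxZl scaleN1r. Qed.

Lemma tensmxNr m n p q (A : 'M[C]_(m, n)) (B : 'M[C]_(p, q)) :
  A *t (- B) = - (A *t B).
Proof. by rewrite -scaleN1r tensmxZr scaleN1r. Qed.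

Lemma tensmxA m n p q r s (A : 'M[C]_(m, n)) (B : 'M[C]_(p, q))
    (D : 'M[C]_(r, s)) :
  A *t (B *t D) = castmx (esym (mulnA _ _ _), esym (mulnA _ _ _)) (A *t B *t D).
Proof.
have idxA a b c (i : 'I_a) (j : 'I_b) (k : 'I_c) :
    cast_ord (mulnA a b c) (mxtens_index (i, mxtens_index (j, k)))
    = mxtens_index (mxtens_index (i, j), k).
  by apply: val_inj; rewrite /= mulnDl addnA mulnA.
apply/matrixP => i j; case: (mxtens_indexP i) => i0 i'.
case: (mxtens_indexP i') => i1 i2; case: (mxtens_indexP j) => j0 j'.
case: (mxtens_indexP j') => j1 j2.
by rewrite castmxE /= !esymK !idxA !tensmxE mulrA.
Qed.

End Tensor.

Local Ltac tens_ring :=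
  rewrite ?(tens0mx, tensmx0, tensmxDl, tensmxDr, tensmxNl, tensmxNr, tensmxZl, tensmxZr);
  repeat match goal with |- context [@tensmx ?r ?m ?n ?p ?q ?A ?B] =>
    move: (@tensmx r m n p q A B) => ? end;
  apply/matrixP => i j; rewrite !mxE; ring.

Section TensorModule.
Variable R : realType.
Local Notation C := R[i].
Implicit Types V W : umodule R.

Lemma umod_weight_basis V : exists P (d : 'rV[C]_(udim V)),
  [/\ P \in unitmx, P *m uH V = diag_mx d *m P
    & P *m uK V = diag_mx (map_mx (@qpow R) d) *m P].
Proof.
have [P uP /diagonalizable_forPex[d /(simmxP uP) PH]] := uH_diag V.
exists P, d; split; [by []|by []|].
have colM (A B : 'M[C]_(udim V)) j : col j (A *m B) = A *m col j B.
  by rewrite !colE mulmxA.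
have HP : uH V *m invmx P = invmx P *m diag_mx d.
  by apply: (canRL (mulKmx uP)); rewrite mulmxA PH mulmxK.
apply: (canRL (mulmxKV uP)); rewrite -mulmxA.
apply: (canLR (mulKVmx uP)); apply/matrixP => i j.
have eH : uH V *m col j (invmx P) = d 0 j *: col j (invmx P).
  by rewrite -colM HP; apply/matrixP => a b; rewrite mul_mx_diag !mxE mulrC.
move: (uK_qH eH); rewrite -colM => /matrixP/(_ i 0).
by rewrite mul_mx_diag !mxE mulrC.
Qed.

Variables V W : umodule R.

Let dim := (udim V * udim W)%N.
Let tE : 'M[C]_dim := 1%:M *t uE W + uE V *t uK W.
Let tF : 'M[C]_dim := invmx (uK V) *t uF W + uF V *t 1%:M.
Let tK : 'M[C]_dim := uK V *t uK W.
Let tH : 'M[C]_dim := uH V *t 1%:M + 1%:M *t uH W.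

Fact tens_K_unit : tK \in unitmx.
Proof. exact: tensmx_unit' (uK_unit V) (uK_unit W). Qed.

Fact tens_KE : tK *m tE *m invmx tK = qpow 2%:R *: tE.
Proof.
rewrite invmx_tens ?uK_unit // mulmxDr mulmxDl !tensmx_mul !uKE mulmx1.
by rewrite !mulmxK ?mulmxV ?uK_unit // tensmxZl tensmxZr scalerDr.
Qed.

Fact tens_KF : tK *m tF *m invmx tK = qpow (- 2%:R) *: tF.
Proof.
rewrite invmx_tens ?uK_unit // mulmxDr mulmxDl !tensmx_mul !uKF mulmx1.
by rewrite !mulmxV ?mul1mx ?uK_unit // tensmxZl tensmxZr scalerDr.
Qed.

Fact tens_EF : tE *m tF - tF *m tE = (qq R - (qq R)^-1)^-1 *: (tK - invmx tK).
Proof.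
have EK : uE V *m invmx (uK V) = qpow 2%:R *: (invmx (uK V) *m uE V).
  by rewrite scalemxAr -uKE !mulmxA mulVmx ?uK_unit // mul1mx.
have KF : uK W *m uF W = qpow (- 2%:R) *: (uF W *m uK W).
  by rewrite scalemxAl -uKF mulmxKV ?uK_unit.
rewrite invmx_tens ?uK_unit // !mulmxDl !mulmxDr !tensmx_mul !mul1mx !mulmx1.
have q1 : qpow 2%:R * qpow (- 2%:R) = 1 :> C by rewrite -qpowD subrr qpow0.
rewrite EK KF tensmxZl tensmxZr scalerA q1 scale1r.
have EF V' : uE V' *m uF V' = uF V' *m uE V' +
    (qq R - (qq R)^-1)^-1 *: (uK V' - invmx (uK V')).
  by rewrite -uEF addrC subrK.
rewrite !EF /tK; move: (_^-1) => s.
by tens_ring.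
Qed.

Fact tens_HK : tH *m tK = tK *m tH.
Proof. by rewrite mulmxDl mulmxDr !tensmx_mul !mul1mx !mulmx1 !uHK. Qed.

Fact tens_HE : tH *m tE - tE *m tH = 2%:R *: tE.
Proof.
have HE V' : uH V' *m uE V' = uE V' *m uH V' + 2%:R *: uE V'.
  by rewrite -uHE addrC subrK.
rewrite !mulmxDl !mulmxDr !tensmx_mul !mul1mx !mulmx1 !HE !uHK.
rewrite /tE.
by tens_ring.
Qed.

Fact tens_HF : tH *m tF - tF *m tH = - 2%:R *: tF.
Proof.
have HF V' : uH V' *m uF V' = uF V' *m uH V' + - 2%:R *: uF V'.
  by rewrite -uHF addrC subrK.
have HKV : uH V *m invmx (uK V) = invmx (uK V) *m uH V.
  apply: (canRL (mulKmx (uK_unit V))).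
  by rewrite mulmxA -uHK mulmxK ?uK_unit.
rewrite !mulmxDl !mulmxDr !tensmx_mul !mul1mx !mulmx1 !HF HKV.
rewrite /tF.
by tens_ring.
Qed.

Fact tens_E2 : tE *m tE = 0.
Proof.
have KE : uK W *m uE W = - (uE W *m uK W).
  by rewrite -scaleN1r -qpow2 scalemxAl -uKE mulmxKV ?uK_unit.
rewrite !mulmxDl !mulmxDr !tensmx_mul !mul1mx !mulmx1 !uE2 KE.
by tens_ring.
Qed.

Fact tens_F2 : tF *m tF = 0.
Proof.
have FK : uF V *m invmx (uK V) = - (invmx (uK V) *m uF V).
  have qN2 : qpow (- 2%:R) = - 1 :> C.
    apply: (mulIr (qpow_unit 2%:R)).
    by rewrite -qpowD addNr qpow0 qpow2 mulrNN mulr1.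
  rewrite -mulmxN; apply: (canRL (mulKmx (uK_unit V))).
  by rewrite mulmxA uKF qN2 scaleN1r.
rewrite !mulmxDl !mulmxDr !tensmx_mul !mul1mx !mulmx1 !uF2 FK.
by tens_ring.
Qed.

Lemma tens_H_basis (P : 'M[C]_(udim V)) (Q : 'M[C]_(udim W)) d e :
  P *m uH V = diag_mx d *m P -> Q *m uH W = diag_mx e *m Q ->
  (P *t Q) *m tH =
  diag_mx (\row_k (d 0 (mxtens_unindex k).1 + e 0 (mxtens_unindex k).2))
    *m (P *t Q).
Proof.
move=> PH QH; rewrite mulmxDr !tensmx_mul !mulmx1 PH QH.
by apply/matrixP => i j; rewrite !mul_diag_mx !mxE; ring.
Qed.

Fact tens_H_diag : diagonalizable tH.
Proof.
have [P [d [uP PH _]]] := umod_weight_basis V.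
have [Q [e [uQ QH _]]] := umod_weight_basis W.
have uPQ := tensmx_unit' uP uQ.
exists (P *t Q) => //; apply/diagonalizable_forPex.
by eexists; apply/(simmxP uPQ)/tens_H_basis; [exact: PH|exact: QH].
Qed.

Fact tens_K_qH (l : C) (v : 'cV[C]_dim) :
  tH *m v = l *: v -> tK *m v = qpow l *: v.
Proof.
have [P [d [uP PH PK]]] := umod_weight_basis V.
have [Q [e [uQ QH QK]]] := umod_weight_basis W.
have uPQ := tensmx_unit' uP uQ; move=> Hv.
have := tens_H_basis PH QH; set r := \row_k _ => PQH.
have PQK : (P *t Q) *m tK = diag_mx (map_mx (@qpow R) r) *m (P *t Q).
  rewrite tensmx_mul PK QK; apply/matrixP => i j.
  by rewrite !mul_diag_mx !mxE qpowD; ring.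
have Hx : diag_mx r *m ((P *t Q) *m v) = l *: ((P *t Q) *m v).
  by rewrite mulmxA -PQH -mulmxA Hv scalemxAr.
apply: (can_inj (mulKmx uPQ)); rewrite -scalemxAr mulmxA PQK -mulmxA.
move: (_ *m v) Hx => x /matrixP Hx; apply/matrixP => i k.
move/(_ i k): Hx; rewrite !mul_diag_mx !mxE => /eqP.
rewrite -subr_eq0 -mulrBl mulf_eq0 subr_eq0 => /orP[/eqP->//|/eqP->].
by rewrite !mulr0.
Qed.

End TensorModule.

(* E, F, K and H act on the tensor product through their coproducts. *)
Definition utens (R : realType) (V W : umodule R) : umodule R :=
  @UModule R (udim V * udim W)
    (1%:M *t uE W + uE V *t uK W)
    (invmx (uK V) *t uF W + uF V *t 1%:M)
    (uK V *t uK W)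
    (uH V *t 1%:M + 1%:M *t uH W)
    (tens_K_unit V W) (tens_KE V W) (tens_KF V W) (tens_EF V W)
    (tens_HK V W) (tens_HE V W) (tens_HF V W) (tens_E2 V W) (tens_F2 V W)
    (tens_H_diag V W) (@tens_K_qH R V W).

Section BasicModules.
Variable R : realType.
Local Notation C := R[i].

Fact unit_rel0 a : (1%:M : 'M[C]_1) *m 0 *m invmx 1%:M = a *: (0 : 'M[C]_1).
Proof. by rewrite mulmx0 mul0mx scaler0. Qed.

Fact unit_EF : (0 : 'M[C]_1) *m (0 : 'M[C]_1) - (0 : 'M[C]_1) *m 0 =
  (qq R - (qq R)^-1)^-1 *: (1%:M - invmx 1%:M).
Proof. by rewrite invmx1 !subrr scaler0. Qed.

Fact unit_HK : (0 : 'M[C]_1) *m (1%:M : 'M[C]_1) = 1%:M *m 0.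
Proof. by rewrite mulmx0 mul0mx. Qed.

Fact unit_H0 a : (0 : 'M[C]_1) *m (0 : 'M[C]_1) - (0 : 'M[C]_1) *m 0 = a *: 0.
Proof. by rewrite subrr scaler0. Qed.

Fact unit_K_qH (l : C) (v : 'cV[C]_1) :
  0 *m v = l *: v -> 1%:M *m v = qpow l *: v.
Proof.
rewrite mul0mx mul1mx => /esym/eqP.
by rewrite scaler_eq0 => /orP[] /eqP->; rewrite ?qpow0 ?scale1r ?scaler0.
Qed.

(* the trivial module, given by the counit *)
Definition uone : umodule R :=
  @UModule R 1 0 0 1%:M 0
    (unitmx1 C 1) (unit_rel0 _) (unit_rel0 _) unit_EF
    unit_HK (unit_H0 _) (unit_H0 _) (mulmx0 1 0) (mulmx0 1 0)
    (@diagonalizable0 C 1) unit_K_qH.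

(* the weights of v_0 and v_1 *)
Definition V0_wt : 'rV[C]_2 := \row_j (-1) ^+ j.

Let E : 'M[C]_2 := delta_mx 0 1.
Let F : 'M[C]_2 := delta_mx 1 0.
Let K : 'M[C]_2 := diag_mx (map_mx (@qpow R) V0_wt).
Let H : 'M[C]_2 := diag_mx V0_wt.
Let KV : 'M[C]_2 := diag_mx (map_mx (fun x => qpow (- x)) V0_wt).

Let K_KV : K *m KV = 1%:M.
Proof.
apply/matrixP => i j; rewrite mul_diag_mx !mxE; case: eqP => [->|_].
  by rewrite !mulr1n -qpowD subrr qpow0.
by rewrite !mulr0n mulr0.
Qed.

Fact V0_K_unit : K \in unitmx.
Proof. by have [] := mulmx1_unit K_KV. Qed.

Let KVE : invmx K = KV.
Proof. by rewrite -[RHS](mulKmx V0_K_unit) K_KV mulmx1. Qed.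

Let wt0 : V0_wt 0 0 = 1. Proof. by rewrite mxE expr0. Qed.
Let wt1 : V0_wt 0 1 = -1. Proof. by rewrite mxE expr1. Qed.
Let I2 (P : 'I_2 -> Prop) : P 0 -> P 1 -> forall i, P i.
Proof.
move=> P0 P1 [[|[|//]] lti]; first by rewrite (_ : Ordinal _ = 0) //; apply: val_inj.
by rewrite (_ : Ordinal _ = 1) //; apply: val_inj.
Qed.

Fact V0_KE : K *m E *m invmx K = qpow 2%:R *: E.
Proof.
rewrite KVE; apply/matrixP; elim/I2; elim/I2;
  rewrite mul_mx_diag mul_diag_mx !mxE /= ?(mulr0, mul0r) //.
by rewrite !expr0 !expr1 opprK mulr1 -qpowD mulr1.
Qed.

Fact V0_KF : K *m F *m invmx K = qpow (- 2%:R) *: F.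
Proof.
rewrite KVE; apply/matrixP; elim/I2; elim/I2;
  rewrite mul_mx_diag mul_diag_mx !mxE /= ?(mulr0, mul0r) //.
by rewrite !expr0 !expr1 mulr1 -qpowD mulr1 -opprD.
Qed.

Fact V0_EF : E *m F - F *m E = (qq R - (qq R)^-1)^-1 *: (K - invmx K).
Proof.
have qV : (qq R)^-1 = qpow (- 1).
  by apply: (mulIr (qpow_unit 1)); rewrite mulVr ?qpow_unit // -qpowD addNr qpow0.
have q_neq0 : qq R - qpow (- 1) != 0.
  rewrite qpowN1 qqE opprK eq_complex /= negb_and !addr0 eqxx /=.
  by rewrite -[1 + 1]/(2%:R) pnatr_eq0.
rewrite !mul_delta_mx KVE qV.
apply/matrixP; elim/I2; elim/I2; rewrite !mxE /= ?(subrr, mulr0) //.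
- by rewrite !mulr1n !expr0 subr0 mulVf.
- by rewrite !mulr1n !expr1 opprK sub0r -[qpow (-1) - _]opprB mulrN mulVf.
Qed.

Fact V0_HK : H *m K = K *m H.
Proof. by rewrite !mulmx_diag; congr diag_mx; apply/rowP => j; rewrite !mxE mulrC. Qed.

Fact V0_HE : H *m E - E *m H = 2%:R *: E.
Proof.
apply/matrixP; elim/I2; elim/I2;
  rewrite mul_mx_diag mul_diag_mx !mxE /= ?(mulr0, mul0r, subrr) //.
by rewrite expr0 expr1; ring.
Qed.

Fact V0_HF : H *m F - F *m H = - 2%:R *: F.
Proof.
apply/matrixP; elim/I2; elim/I2;
  rewrite mul_mx_diag mul_diag_mx !mxE /= ?(mulr0, mul0r, subrr) //.
by rewrite expr0 expr1; ring.
Qed.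

Fact V0_E2 : E *m E = 0. Proof. by rewrite mul_delta_mx_0. Qed.
Fact V0_F2 : F *m F = 0. Proof. by rewrite mul_delta_mx_0. Qed.

Fact V0_K_qH (l : C) (v : 'cV[C]_2) :
  H *m v = l *: v -> K *m v = qpow l *: v.
Proof.
move=> /matrixP Hv; apply/matrixP => i k; move/(_ i k): Hv.
rewrite !mul_diag_mx !mxE => /eqP.
rewrite -subr_eq0 -mulrBl mulf_eq0 subr_eq0 => /orP[/eqP->//|/eqP->].
by rewrite !mulr0.
Qed.

(* v_0 and v_1 are the basis columns of indices 0 and 1 *)
Definition V0 : umodule R :=
  @UModule R 2 (delta_mx 0 1) (delta_mx 1 0)
    (diag_mx (map_mx (@qpow R) V0_wt)) (diag_mx V0_wt)
    V0_K_unit V0_KE V0_KF V0_EF V0_HK V0_HE V0_HF V0_E2 V0_F2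
    (diagonalizable_diag _) V0_K_qH.

End BasicModules.

Section Intertwiners.
Variables (F : fieldType) (m n : nat).

Definition intertwiners (B : 'M[F]_n) (A : 'M[F]_m) : {vspace 'M[F]_(m, n)} :=
  lker (linfun (mulmx A \- mulmxr B)).

Lemma mem_intertwiners B A (f : 'M[F]_(m, n)) :
  (f \in intertwiners B A) = (A *m f == f *m B).
Proof. by rewrite memv_ker lfunE /= subr_eq0. Qed.

End Intertwiners.

Section Hom.
Variables (R : realType) (V W : umodule R).

(* K^-1 is not listed: commuting with K suffices. *)
Definition uhom : {vspace 'M[R[i]]_(udim W, udim V)} :=
  (intertwiners (uE V) (uE W) :&: intertwiners (uF V) (uF W) :&:
   intertwiners (uK V) (uK W) :&: intertwiners (uH V) (uH W))%VS.

Lemma uhomP (f : 'M[R[i]]_(udim W, udim V)) :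
  reflect [/\ uE W *m f = f *m uE V, uF W *m f = f *m uF V,
              uK W *m f = f *m uK V & uH W *m f = f *m uH V]
          (f \in uhom).
Proof.
apply: (iffP idP) => [|[e1 e2 e3 e4]].
  move=> /memv_capP[/memv_capP[/memv_capP[h1 h2] h3] h4].
  split; apply/eqP; rewrite -mem_intertwiners.
  - exact: h1.
  - exact: h2.
  - exact: h3.
  - exact: h4.
apply/memv_capP; split; [apply/memv_capP; split; [apply/memv_capP; split|]|];
  rewrite mem_intertwiners; apply/eqP.
- exact: e1.
- exact: e2.
- exact: e3.
- exact: e4.
Qed.

End Hom.

Section Braiding.
Variable R : realType.
Local Notation C := R[i].

Definition is_qHH (V W : umodule R) (T : 'M[C]_(udim V * udim W)) :=
  forall (l l' : C) (v : 'cV[C]_(udim V)) (w : 'cV[C]_(udim W)),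
    uH V *m v = l *: v -> uH W *m w = l' *: w ->
    T *m (v *t w) = qpow (l * l' / 2%:R) *: (v *t w).

(* q^(H (x) H / 2), by its values on tensors of weight vectors; these span *)
Definition qHH (V W : umodule R) : 'M[C]_(udim V * udim W) :=
  xget 0 [set T | @is_qHH V W T].

Lemma qHHP (V W : umodule R) : @is_qHH V W (qHH V W).
Proof.
suff [T HT] : exists T, @is_qHH V W T.
  exact: (@xgetPex _ 0 [set T | @is_qHH V W T] (ex_intro _ T HT)).
have [P [d [uP PH _]]] := umod_weight_basis V.
have [Q [e [uQ QH _]]] := umod_weight_basis W.
pose r : 'rV[C]_(udim V * udim W) := \row_k
  qpow (d 0 (mxtens_unindex k).1 * e 0 (mxtens_unindex k).2 / 2%:R).
exists (invmx (P *t Q) *m diag_mx r *m (P *t Q)) => l l' v w Hv Hw.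
have uPQ := tensmx_unit' uP uQ.
apply: (can_inj (mulKmx uPQ)).
rewrite -scalemxAr -!mulmxA mulKVmx // tensmx_mul.
have {Hv} Hx : diag_mx d *m (P *m v) = l *: (P *m v).
  by rewrite mulmxA -PH -mulmxA Hv scalemxAr.
have {Hw} Hy : diag_mx e *m (Q *m w) = l' *: (Q *m w).
  by rewrite mulmxA -QH -mulmxA Hw scalemxAr.
move: (P *m v) (Q *m w) Hx Hy => x y /matrixP Hx /matrixP Hy.
apply/matrixP => k j; move: (Hx (mxtens_unindex k).1 (mxtens_unindex j).1).
move: (Hy (mxtens_unindex k).2 (mxtens_unindex j).2).
rewrite !mul_diag_mx !mxE => /eqP.
rewrite -subr_eq0 -mulrBl mulf_eq0 subr_eq0 => /orP[/eqP->|/eqP->]; last first.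
  by rewrite !mulr0.
move=> /eqP; rewrite -subr_eq0 -mulrBl mulf_eq0 subr_eq0.
by move=> /orP[/eqP->//|/eqP->]; rewrite !(mul0r, mulr0).
Qed.

Definition flipmx (m n : nat) : 'M[C]_(n * m, m * n) :=
  \matrix_(i, j) (((mxtens_unindex i).1 == (mxtens_unindex j).2) &&
                  ((mxtens_unindex i).2 == (mxtens_unindex j).1))%:R.

Lemma flipmxE m n p q (A : 'M[C]_(m, p)) (B : 'M[C]_(n, q)) :
  flipmx m n *m (A *t B) = (B *t A) *m flipmx p q.
Proof.
apply/matrixP => i j; case: (mxtens_indexP i) => i1 i2.
case: (mxtens_indexP j) => j1 j2.
rewrite !mxE (bigD1 (mxtens_index (i2, i1))) //= big1 ?addr0; last first.
  move=> k; case: (mxtens_indexP k) => k1 k2 /negP ne.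
  rewrite !mxE !mxtens_indexK /=; case: andP => [[/eqP e1 /eqP e2]|].
    by case: ne; rewrite e1 e2.
  by rewrite mul0r.
rewrite (bigD1 (mxtens_index (j2, j1))) //= big1 ?addr0; last first.
  move=> k; case: (mxtens_indexP k) => k1 k2 /negP ne.
  rewrite !mxE !mxtens_indexK /=; case: andP => [[/eqP e1 /eqP e2]|].
    by case: ne; rewrite e1 e2.
  by rewrite mulr0.
by rewrite !mxE !mxtens_indexK /= !eqxx mul1r mulr1 mulrC.
Qed.

(* R = q^(H (x) H / 2) (1 + {1} E (x) F) *)
Definition Rmx (V W : umodule R) : 'M[C]_(udim V * udim W) :=
  qHH V W *m (1%:M + qbrace 1 *: (uE V *t uF W)).

Definition braiding (V W : umodule R) :
    'M[C]_(udim (utens W V), udim (utens V W)) :=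
  flipmx (udim V) (udim W) *m Rmx V W.

(* V (x) (V (x) ( ... (x) 1)), with m factors V *)
Fixpoint upow (V : umodule R) (m : nat) : umodule R :=
  if m is m'.+1 then utens V (upow V m') else uone R.

(* c_{V,V} in positions i, i+1 (counted from 0) of the m-th tensor power; the
   cast is the associativity V (x) (V (x) W) = (V (x) V) (x) W, see tensmxA.
   Only i + 1 < m is meaningful, and the value is the identity otherwise. *)
Fixpoint braiding_at (V : umodule R) (m i : nat) {struct m} :
    'M[C]_(udim (upow V m)) :=
  match m return 'M[C]_(udim (upow V m)) with
  | 0 => 1%:M
  | m1.+1 =>
    match i with
    | i'.+1 => 1%:M *t braiding_at V m1 i'
    | 0 =>
      match m1 return 'M[C]_(udim (upow V m1.+1)) with
      | 0 => 1%:M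
      | m2.+1 =>
        castmx (esym (mulnA _ _ _), esym (mulnA _ _ _))
          (braiding V V *t (1%:M : 'M[C]_(udim (upow V m2))))
      end
    end
  end.

End Braiding.

Section BraidGroup.
Variable m : nat.

(* (i, false) is the generator sigma_i and (i, true) its inverse *)
Definition braid_word := seq ('I_m.-1 * bool).
Implicit Types u v w : braid_word.

(* the congruence generated by the defining relations of Br_m *)
Inductive braid_eq : braid_word -> braid_word -> Prop :=
| BraidRefl w : braid_eq w w
| BraidSym u v of braid_eq u v : braid_eq v u
| BraidTrans u v w of braid_eq u v & braid_eq v w : braid_eq u w
| BraidCat u u' v v' of braid_eq u u' & braid_eq v v' :
    braid_eq (u ++ v) (u' ++ v')
| BraidCancel i b : braid_eq [:: (i, b); (i, ~~ b)] [::]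
| BraidFar (i j : 'I_m.-1) of (i.+1 < j)%N :
    braid_eq [:: (i, false); (j, false)] [:: (j, false); (i, false)]
| BraidYB (i j : 'I_m.-1) of j = i.+1 :> nat :
    braid_eq [:: (i, false); (j, false); (i, false)]
             [:: (j, false); (i, false); (j, false)].

Definition braid_eqb : rel braid_word := fun u v => `[< braid_eq u v >].

Fact braid_eqb_refl : reflexive braid_eqb.
Proof. by move=> u; apply/asboolP; constructor. Qed.

Fact braid_eqb_sym : symmetric braid_eqb.
Proof. by move=> u v; apply/asboolP/asboolP; apply: BraidSym. Qed.

Fact braid_eqb_trans : transitive braid_eqb.
Proof. by move=> v u w /asboolP uv /asboolP vw; apply/asboolP/(BraidTrans uv). Qed.

Canonical braid_equiv :=
  EquivRel braid_eqb braid_eqb_refl braid_eqb_sym braid_eqb_trans.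

Definition braid_group := {eq_quot braid_equiv}%qT.

HB.instance Definition _ := Choice.on braid_group.

Definition braid_of (w : braid_word) : braid_group := (\pi_{eq_quot braid_equiv} w)%qT.

Lemma braid_ofP u v : braid_of u = braid_of v <-> braid_eq u v.
Proof. by split=> [/eqmodP/asboolP|H] //; apply/eqmodP/asboolP. Qed.

Definition braid_repr (b : braid_group) : braid_word := repr b.

Lemma braid_reprK b : braid_of (braid_repr b) = b.
Proof. exact: reprK. Qed.

Lemma braid_reprP u : braid_eq (braid_repr (braid_of u)) u.
Proof. by apply/braid_ofP; rewrite braid_reprK. Qed.

Definition word_inv (w : braid_word) : braid_word :=
  rev [seq (x.1, ~~ x.2) | x <- w].

Lemma word_invK : involutive word_inv.
Proof.
move=> w; rewrite /word_inv map_rev revK -map_comp -[RHS]map_id.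
by apply: eq_map => -[i b] /=; rewrite negbK.
Qed.

Lemma word_invV w : braid_eq (w ++ word_inv w) [::].
Proof.
elim: w => [|[i b] w IH]; first exact: BraidRefl.
have -> : ((i, b) :: w) ++ word_inv ((i, b) :: w) =
    [:: (i, b)] ++ ((w ++ word_inv w) ++ [:: (i, ~~ b)]).
  by rewrite /word_inv /= rev_cons -cats1 catA.
apply: (BraidTrans (v := [:: (i, b)] ++ ([::] ++ [:: (i, ~~ b)]))).
  apply: BraidCat; first exact: BraidRefl.
  by apply: BraidCat; [exact: IH | exact: BraidRefl].
exact: BraidCancel.
Qed.

Definition braid_one : braid_group := braid_of [::].
Definition braid_mul (a b : braid_group) : braid_group :=
  braid_of (braid_repr a ++ braid_repr b).
Definition braid_inv (a : braid_group) : braid_group :=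
  braid_of (word_inv (braid_repr a)).

Lemma braid_mul_of u v : braid_mul (braid_of u) (braid_of v) = braid_of (u ++ v).
Proof. by apply/braid_ofP; apply: BraidCat; apply: braid_reprP. Qed.

Fact braid_mulA : associative braid_mul.
Proof.
move=> a b c; rewrite -(braid_reprK a) -(braid_reprK b) -(braid_reprK c).
by rewrite !braid_mul_of catA.
Qed.

Fact braid_mul1 : left_id braid_one braid_mul.
Proof. by move=> a; rewrite -(braid_reprK a) braid_mul_of. Qed.

Fact braid_mulr1 : right_id braid_one braid_mul.
Proof. by move=> a; rewrite -(braid_reprK a) braid_mul_of cats0. Qed.

Fact braid_mulV : left_inverse braid_one braid_inv braid_mul.
Proof.
move=> a; rewrite -{2}(braid_reprK a) braid_mul_of; apply/braid_ofP.
by rewrite -{2}[braid_repr a]word_invK; apply: word_invV.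
Qed.

Fact braid_mulrV : right_inverse braid_one braid_inv braid_mul.
Proof.
move=> a; rewrite -{1}(braid_reprK a) braid_mul_of; apply/braid_ofP.
exact: word_invV.
Qed.

HB.instance Definition _ := isGroup.Build braid_group braid_mulA braid_mul1
  braid_mulr1 braid_mulV braid_mulrV.

Definition sigma (i : 'I_m.-1) : braid_group := braid_of [:: (i, false)].

End BraidGroup.

Section Representation.
Variable R : realType.
Local Notation C := R[i].

(* Hom(V_0, V_0^(x)(2n+1)), as a space of its own *)
Definition Hspace (n : nat) : vectType C :=
  subvs_of (uhom (V0 R) (upow (V0 R) (2 * n + 1))).

(* rho is the action of the braid group by braiding.  The sigma_i generate, so
   the last condition determines rho. *)
Definition is_braid_action (n : nat)
    (rho : braid_group (2 * n + 1) -> 'End(Hspace n)) :=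
  [/\ rho 1%g = \1%VF,
      forall a b, rho (a * b)%g = (rho a \o rho b)%VF
    & forall i f,
        vsval (rho (sigma i) f) = braiding_at (V0 R) (2 * n + 1) i *m vsval f].

End Representation.

Section Signature.
Variables (C : numClosedFieldType) (U : vectType C).
Variable h : {hermitian_sym U for (@Num.conj C)}.

(* h has p positive and q negative squares in an orthogonal basis *)
Definition has_signature (p q : nat) :=
  exists2 e : (\dim {:U}).-tuple U, basis_of fullv e &
    [/\ forall i j, i != j -> h (tnth e i) (tnth e j) = 0,
        #|[set i | 0 < h (tnth e i) (tnth e i)]| = p
      & #|[set i | h (tnth e i) (tnth e i) < 0]| = q].

Definition mixed_signature :=
  exists p q, [/\ has_signature p q, (0 < p)%N & (0 < q)%N].

Definition positive_definite := forall u, u != 0 -> 0 < h u u.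
Definition negative_definite := forall u, u != 0 -> h u u < 0.

Lemma mixed_signature_indefinite :
  mixed_signature -> ~ positive_definite /\ ~ negative_definite.
Proof.
move=> [p [q [[e be [_ <- <-]]]]].
case/card_gt0P=> i; rewrite inE => pi; case/card_gt0P=> j; rewrite inE => nj.
have e0 k : tnth e k != 0 by apply: (free_not0 (basis_free be)); apply: mem_tnth.
split=> def_h; first by have := lt_trans nj (def_h _ (e0 j)); rewrite ltxx.
by have := lt_trans pi (def_h _ (e0 i)); rewrite ltxx.
Qed.

End Signature.

(* Main.v *)
Require Import Defs.
From HB Require Import structures.
From mathcomp Require Import all_boot all_order all_algebra.
From mathcomp Require Import reals complex mxtens ring.

(** On V_0 (x) V_0 the braiding is s (1 + e), where s^2 = q and e = b b^T for
    the invariant vector b = v_1 (x) v_0 - i v_0 (x) v_1, which satisfies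
    b^T b = 0.  The operators e_i obtained from e in positions i, i+1 satisfy
    the Temperley-Lieb relations e_i^2 = 0 and e_i e_j e_i = - e_i (|i-j| = 1),
    which give the braid relations.

    Let X swap v_0 and v_1 in every tensor factor.  Then e_i^* X = - X e_i, so
    the braiding preserves the sesquilinear pairing (x, y) |-> x^* X y, which
    pairs the weight l with the weight -l.  A morphism f from V_0 is determined
    by the highest weight vector u = f v_0, of weight 1, and f v_1 = F u; hence
    (f, g) |-> (g v_0)^* X (f v_1) is an invariant form, Hermitian because
    F^* X = X F.  Pairing f with the morphism given by the highest weight
    vector E X u yields |u|^2, so the form is non-degenerate.  The morphism
    given by b (x) u' is isotropic since b^T b = 0, and a non-degenerate form
    with a non-zero isotropic vector is indefinite.

    Finally v_0 (x) a + v_1 (x) b' is a highest weight vector of weight 1 in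
    V_0 (x) U iff a has weight 0 and b' = E a, so the dimension is that of the
    weight 0 subspace of V_0^{(x) 2n}. *)

Set Implicit Arguments.
Unset Strict Implicit.
Unset Printing Implicit Defensive.

Import Order.TTheory GRing.Theory Num.Theory.
Local Open Scope ring_scope.

(** * Block columns of a tensor product *)

Section TensorColumns.
Variable R : comNzRingType.

(** The matrix of x |-> v_j (x) x. *)
Definition tcol n d (j : 'I_n) : 'M[R]_(n * d, d) :=
  \matrix_(k, l) (k == mxtens_index (j, l))%:R.

Lemma mul_tcol m n d (M : 'M[R]_(m, n * d)) (j : 'I_n) i l :
  (M *m tcol d j) i l = M i (mxtens_index (j, l)).
Proof.
rewrite mxE (bigD1 (mxtens_index (j, l))) //= mxE eqxx mulr1 big1 ?addr0 // => k nk.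
by rewrite mxE (negPf nk) mulr0.
Qed.

(** Lets identities on a tensor product be checked on the vectors v_j (x) x, with x kept symbolic,
    so that most index computations disappear later. *)
Lemma tcol_inj m n d (M N : 'M[R]_(m, n * d)) :
  (forall j, M *m tcol d j = N *m tcol d j) -> M = N.
Proof.
move=> MN; apply/matrixP => i k; case: (mxtens_indexP k) => j l.
by rewrite -!mul_tcol MN.
Qed.

Lemma tr_tcol_mul n d (i j : 'I_n) : (tcol d i)^T *m tcol d j = (i == j)%:R%:M.
Proof.
apply/matrixP => k l; rewrite mul_tcol !mxE (can_eq (@mxtens_indexK _ _)).
by rewrite xpair_eqE -mulnb natrM mulr_natr [j == i]eq_sym [l == k]eq_sym.
Qed.

Lemma tens_tcol m n c d (A : 'M[R]_(m, n)) (B : 'M[R]_(c, d)) j :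
  (A *t B) *m tcol d j = \sum_i A i j *: (tcol c i *m B).
Proof.
apply/matrixP => k l; rewrite mul_tcol; case: (mxtens_indexP k) => i r.
rewrite tensmxE summxE (bigD1 i) //= big1 ?addr0.
  rewrite !mxE (bigD1 r) //= big1 ?addr0 => [|r' nr].
    by rewrite mxE eqxx mul1r.
  by rewrite mxE (can_eq (@mxtens_indexK _ _)) xpair_eqE eqxx eq_sym (negPf nr) mul0r.
move=> i' ni; rewrite !mxE big1 ?mulr0 // => r' _.
by rewrite mxE (can_eq (@mxtens_indexK _ _)) xpair_eqE eq_sym (negPf ni) mul0r.
Qed.

Lemma sum_tcol n d : \sum_i tcol d i *m (tcol d i)^T = 1%:M :> 'M[R]_(n * d).
Proof.
apply: tcol_inj => j; rewrite mul1mx mulmx_suml (bigD1 j) //= big1 => [|i nij].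
  by rewrite -mulmxA tr_tcol_mul eqxx mulmx1 addr0.
by rewrite -mulmxA tr_tcol_mul (negPf nij) raddf0 mulmx0.
Qed.
End TensorColumns.

Lemma ord2_ind (P : 'I_2 -> Prop) : P 0 -> P 1 -> forall i, P i.
Proof.
move=> P0 P1 [[|[|//]] lti]; first by rewrite (_ : Ordinal _ = 0) //; apply: val_inj.
by rewrite (_ : Ordinal _ = 1) //; apply: val_inj.
Qed.

Lemma big_ord2 (V : nmodType) (F : 'I_2 -> V) : \sum_i F i = F 0 + F 1.
Proof. by rewrite big_ord_recl big_ord1; congr (_ + F _); apply: val_inj. Qed.

Local Ltac lin_abs := repeat match goal with
  | |- context [@mulmx ?r ?m ?n ?p ?A ?B] => move: (@mulmx r m n p A B) => ? end;
  try (apply/matrixP => ? ?; rewrite !mxE).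

(** * The generators on V_0 (x) W *)

Section V0tens.
Variable R : realType.
Local Notation C := R[i].
Local Notation I := ('i : C).
Local Notation c0 d := (tcol C d (0 : 'I_2)).
Local Notation c1 d := (tcol C d (1 : 'I_2)).

(** Passed to [ring] below as the rule that reduces powers of [I]. *)
Lemma mul_ii : I * I = -1.
Proof. exact: mulCii. Qed.

Lemma qpowN (x : C) : qpow (- x) = (qpow x)^-1.
Proof. by apply: (mulIr (qpow_unit x)); rewrite -qpowD addNr qpow0 mulVr ?qpow_unit. Qed.

Lemma qpow1 : qpow 1 = I.
Proof. by rewrite -/(qq R) qqE complexiE. Qed.

Lemma inv_i : I^-1 = - I.
Proof. by rewrite -qpow1 -qpowN qpowN1 qpow1. Qed.

Section W.
Variable W : umodule R.
Local Notation d := (udim W).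
Local Notation VW := (utens (V0 R) W).

Lemma uE_tcol0 : uE VW *m c0 d = c0 d *m uE W.
Proof.
by rewrite mulmxDl !tens_tcol !big_ord2 !mxE /= !(scale0r, scale1r, add0r, addr0).
Qed.
Lemma uE_tcol1 : uE VW *m c1 d = c1 d *m uE W + c0 d *m uK W.
Proof.
by rewrite mulmxDl !tens_tcol !big_ord2 !mxE /= !(scale0r, scale1r, add0r, addr0).
Qed.
Lemma uK_tcol0 : uK VW *m c0 d = I *: (c0 d *m uK W).
Proof.
by rewrite !tens_tcol !big_ord2 !mxE /= !(scale0r, scale1r, add0r, addr0) mulr1n -qpow1.
Qed.
Lemma uK_tcol1 : uK VW *m c1 d = - I *: (c1 d *m uK W).
Proof.
by rewrite !tens_tcol !big_ord2 !mxE /= !(scale0r, scale1r, add0r, addr0) mulr1n expr1 qpowN1.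
Qed.
Lemma uH_tcol0 : uH VW *m c0 d = c0 d *m uH W + c0 d.
Proof.
by rewrite mulmxDl !tens_tcol !big_ord2 !mxE /= !(scale0r, scale1r, add0r, addr0) mulmx1 addrC.
Qed.
Lemma uH_tcol1 : uH VW *m c1 d = c1 d *m uH W - c1 d.
Proof.
by rewrite mulmxDl !tens_tcol !big_ord2 !mxE /= !(scale0r, scale1r, add0r, addr0) mulmx1 addrC
  mulr1n expr1 scaleN1r.
Qed.

Lemma invK_V0 : invmx (uK (V0 R)) = - I *: delta_mx 0 0 + I *: delta_mx 1 1.
Proof.
(* Multiplication by K turns the claim into the statement that K times the right-hand side is the
   identity. *)
rewrite -[RHS](mulKmx (V0_K_unit R)) -[LHS]mulmx1; congr (_ *m _) => /=.
rewrite mul_diag_mx; apply/matrixP; elim/ord2_ind; elim/ord2_ind; rewrite !mxE /=;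
  rewrite ?mulr1n ?mulr0n ?expr0 ?expr1 ?qpowN1 ?qpow1; ring: mul_ii.
Qed.

Lemma uF_tcol0 : uF VW *m c0 d = c1 d - I *: (c0 d *m uF W).
Proof.
rewrite mulmxDl !tens_tcol !big_ord2 invK_V0 !mxE /= !mulr0 !mulr1.
by rewrite !(scale0r, scale1r, add0r, addr0) mulmx1 scaleNr addrC.
Qed.
Lemma uF_tcol1 : uF VW *m c1 d = I *: (c1 d *m uF W).
Proof.
rewrite mulmxDl !tens_tcol !big_ord2 invK_V0 !mxE /= !mulr0 !mulr1.
by rewrite !(scale0r, scale1r, add0r, addr0).
Qed.

Section Right.
Variables (p : nat) (N : 'M[C]_(d, p)).
Lemma uE_tcol0r : uE VW *m (c0 d *m N) = c0 d *m (uE W *m N).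
Proof. by rewrite mulmxA uE_tcol0 -mulmxA. Qed.
Lemma uE_tcol1r : uE VW *m (c1 d *m N) = c1 d *m (uE W *m N) + c0 d *m (uK W *m N).
Proof. by rewrite mulmxA uE_tcol1 mulmxDl -!mulmxA. Qed.
Lemma uK_tcol0r : uK VW *m (c0 d *m N) = I *: (c0 d *m (uK W *m N)).
Proof. by rewrite mulmxA uK_tcol0 -scalemxAl -mulmxA. Qed.
Lemma uK_tcol1r : uK VW *m (c1 d *m N) = - I *: (c1 d *m (uK W *m N)).
Proof. by rewrite mulmxA uK_tcol1 -scalemxAl -mulmxA. Qed.
Lemma uH_tcol0r : uH VW *m (c0 d *m N) = c0 d *m (uH W *m N) + c0 d *m N.
Proof. by rewrite mulmxA uH_tcol0 mulmxDl -!mulmxA. Qed.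
Lemma uH_tcol1r : uH VW *m (c1 d *m N) = c1 d *m (uH W *m N) - c1 d *m N.
Proof. by rewrite mulmxA uH_tcol1 mulmxBl -!mulmxA. Qed.
Lemma uF_tcol0r : uF VW *m (c0 d *m N) = c1 d *m N - I *: (c0 d *m (uF W *m N)).
Proof. by rewrite mulmxA uF_tcol0 mulmxBl -scalemxAl -!mulmxA. Qed.
Lemma uF_tcol1r : uF VW *m (c1 d *m N) = I *: (c1 d *m (uF W *m N)).
Proof. by rewrite mulmxA uF_tcol1 -scalemxAl -!mulmxA. Qed.
End Right.
End W.

(** * The invariant vector b, its cup and its cap *)

Lemma tr_tcol00 d : (c0 d)^T *m c0 d = 1%:M. Proof. exact: tr_tcol_mul. Qed.
Lemma tr_tcol11 d : (c1 d)^T *m c1 d = 1%:M. Proof. exact: tr_tcol_mul. Qed.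
Lemma tr_tcol01 d : (c0 d)^T *m c1 d = 0. Proof. by rewrite tr_tcol_mul raddf0. Qed.
Lemma tr_tcol10 d : (c1 d)^T *m c0 d = 0. Proof. by rewrite tr_tcol_mul raddf0. Qed.

(** x |-> b (x) x; its transpose contracts with b. *)
Definition ucup d : 'M[C]_(2 * (2 * d), d) :=
  c1 (2 * d) *m c0 d - I *: (c0 (2 * d) *m c1 d).

Lemma cap_tcol0 d : (ucup d)^T *m c0 (2 * d) = - I *: (c1 d)^T.
Proof.
rewrite linearB linearZ /= !trmx_mul mulmxBl -scalemxAl -!mulmxA tr_tcol00 tr_tcol10.
by rewrite mulmx0 mulmx1 sub0r scaleNr.
Qed.
Lemma cap_tcol1 d : (ucup d)^T *m c1 (2 * d) = (c0 d)^T.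
Proof.
rewrite linearB linearZ /= !trmx_mul mulmxBl -scalemxAl -!mulmxA tr_tcol01 tr_tcol11.
by rewrite mulmx0 mulmx1 scaler0 subr0.
Qed.

Lemma cap_tcol0r d p (N : 'M_(_, p)) : (ucup d)^T *m (c0 (2 * d) *m N) = - I *: ((c1 d)^T *m N).
Proof. by rewrite mulmxA cap_tcol0 -scalemxAl. Qed.
Lemma cap_tcol1r d p (N : 'M_(_, p)) : (ucup d)^T *m (c1 (2 * d) *m N) = (c0 d)^T *m N.
Proof. by rewrite mulmxA cap_tcol1. Qed.

(** This is b^T b = 1 + (-i)^2 = 0, the vanishing loop value of the Temperley-Lieb algebra. *)
Lemma cap_cup d : (ucup d)^T *m ucup d = 0.
Proof.
rewrite {2}/ucup mulmxBr -scalemxAr !mulmxA cap_tcol0 cap_tcol1 -scalemxAl tr_tcol00 tr_tcol11.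
by rewrite scalerA mulrN mul_ii opprK scale1r subrr.
Qed.

Lemma tens1_c0 c d (M : 'M[C]_(c, d)) : (1%:M *t M) *m c0 d = c0 c *m M.
Proof. by rewrite tens_tcol big_ord2 !mxE scale1r scale0r addr0. Qed.
Lemma tens1_c1 c d (M : 'M[C]_(c, d)) : (1%:M *t M) *m c1 d = c1 c *m M.
Proof. by rewrite tens_tcol big_ord2 !mxE scale1r scale0r add0r. Qed.

(** The zigzag identity, up to the scalar -i. Two zigzags give (-i)^2 = -1, which is the sign in e_i
    e_j e_i = - e_i. *)
Lemma cap_tens_cup d : (ucup (2 * d))^T *m (1%:M *t ucup d) = - I *: 1%:M.
Proof.
apply: tcol_inj; elim/ord2_ind; rewrite -mulmxA ?tens1_c0 ?tens1_c1 mulmxA ?cap_tcol0 ?cap_tcol1.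
  rewrite -!scalemxAl mul1mx /ucup mulmxBr -scalemxAr !mulmxA tr_tcol10 tr_tcol11.
  by rewrite mul0mx mul1mx scaler0 subr0.
rewrite -!scalemxAl mul1mx /ucup mulmxBr -scalemxAr !mulmxA tr_tcol00 tr_tcol01.
by rewrite mul0mx mul1mx sub0r scaleNr.
Qed.

Section Cup.
Variable W : umodule R.
Local Notation d := (udim W).
Local Notation VVW := (utens (V0 R) (utens (V0 R) W)).

(** E and F kill b, K fixes it and it has weight 0, so inserting b in front of W is a module
    morphism. The statements for F, K and H follow, then those for the contraction with b. *)
Lemma uE_cup : uE VVW *m ucup d = ucup d *m uE W.
Proof.
rewrite /ucup mulmxBr -scalemxAr uE_tcol0r uE_tcol1r uE_tcol0 uK_tcol0 uE_tcol1 mulmxBl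
  -scalemxAl -!mulmxA.
by rewrite !mulmxDr scalerDr opprD -scalemxAr -addrA; congr (_ + _); rewrite addrC subrK.
Qed.
Lemma uF_cup : uF VVW *m ucup d = ucup d *m uF W.
Proof.
rewrite /ucup mulmxBr -scalemxAr uF_tcol0r uF_tcol1r uF_tcol0 uF_tcol1 mulmxBl -scalemxAl -!mulmxA.
rewrite mulmxBr -!scalemxAr.
lin_abs; ring: mul_ii.
Qed.
Lemma uK_cup : uK VVW *m ucup d = ucup d *m uK W.
Proof.
rewrite /ucup mulmxBr -scalemxAr uK_tcol0r uK_tcol1r uK_tcol0 uK_tcol1 mulmxBl -scalemxAl -!mulmxA.
rewrite -!scalemxAr.
lin_abs; ring: mul_ii.
Qed.
Lemma uH_cup : uH VVW *m ucup d = ucup d *m uH W.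
Proof.
rewrite /ucup mulmxBr -scalemxAr uH_tcol0r uH_tcol1r uH_tcol0 uH_tcol1 mulmxBl -scalemxAl -!mulmxA.
rewrite mulmxBr mulmxDr.
lin_abs; ring: mul_ii.
Qed.

Lemma cap_tcol_inj (M : 'M_(udim VVW)) (N : 'M_d) :
  (forall i j, (ucup d)^T *m (M *m (tcol C _ i *m tcol C _ j)) =
    N *m ((ucup d)^T *m (tcol C _ i *m tcol C _ j))) ->
  (ucup d)^T *m M = N *m (ucup d)^T.
Proof. by move=> MN; do 2!apply: tcol_inj => ?; rewrite -!mulmxA. Qed.

Lemma tr_tcol00r e p (N : 'M_(e, p)) : (c0 e)^T *m (c0 e *m N) = N.
Proof. by rewrite mulmxA tr_tcol00 mul1mx. Qed.
Lemma tr_tcol11r e p (N : 'M_(e, p)) : (c1 e)^T *m (c1 e *m N) = N.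
Proof. by rewrite mulmxA tr_tcol11 mul1mx. Qed.
Lemma tr_tcol01r e p (N : 'M_(e, p)) : (c0 e)^T *m (c1 e *m N) = 0.
Proof. by rewrite mulmxA tr_tcol01 mul0mx. Qed.
Lemma tr_tcol10r e p (N : 'M_(e, p)) : (c1 e)^T *m (c0 e *m N) = 0.
Proof. by rewrite mulmxA tr_tcol10 mul0mx. Qed.

Definition capE := (mulmxDr, mulmxN, =^~ scalemxAr, cap_tcol0r, cap_tcol1r,
  tr_tcol00r, tr_tcol01r, tr_tcol10r, tr_tcol11r,
  tr_tcol00, tr_tcol01, tr_tcol10, tr_tcol11, mulmx0, mulmx1, scaler0).

Lemma uE_cap : (ucup d)^T *m uE VVW = uE W *m (ucup d)^T.
Proof.
apply: cap_tcol_inj; elim/ord2_ind; elim/ord2_ind;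
  rewrite ?uE_tcol0r ?uE_tcol1r ?uE_tcol0 ?uE_tcol1 ?uK_tcol0 ?uK_tcol1 !capE;
  lin_abs; ring: mul_ii.
Qed.
Lemma uF_cap : (ucup d)^T *m uF VVW = uF W *m (ucup d)^T.
Proof.
apply: cap_tcol_inj; elim/ord2_ind; elim/ord2_ind;
  rewrite ?uF_tcol0r ?uF_tcol1r ?uF_tcol0 ?uF_tcol1 !capE;
  lin_abs; ring: mul_ii.
Qed.
Lemma uK_cap : (ucup d)^T *m uK VVW = uK W *m (ucup d)^T.
Proof.
apply: cap_tcol_inj; elim/ord2_ind; elim/ord2_ind;
  rewrite ?uK_tcol0r ?uK_tcol1r ?uK_tcol0 ?uK_tcol1 !capE;
  lin_abs; ring: mul_ii.
Qed.
Lemma uH_cap : (ucup d)^T *m uH VVW = uH W *m (ucup d)^T.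
Proof.
apply: cap_tcol_inj; elim/ord2_ind; elim/ord2_ind;
  rewrite ?uH_tcol0r ?uH_tcol1r ?uH_tcol0 ?uH_tcol1 !capE;
  lin_abs; ring: mul_ii.
Qed.
End Cup.

(** * The braiding of V_0 with itself as s (1 + e) *)

Lemma qpowN_half : qpow (- (1 / 2%:R) : C) = - I * qpow (1 / 2%:R).
Proof.
by rewrite -qpowN1 -qpowD; congr qpow; field.
Qed.

Lemma qbrace1 : qbrace (1 : C) = 2%:R * I.
Proof. by rewrite /qbrace qpow1 qpowN1 opprK mulr_natl. Qed.

Local Notation wt := (V0_wt R 0).
Lemma wtE (k : 'I_2) : wt k = if k == 0 then 1 else -1.
Proof. by elim/ord2_ind: k; rewrite mxE. Qed.

(** Among the v_k (x) v_l only v_1 (x) v_0 survives E (x) F. Its image v_0 (x) v_1 has weights 1 and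
    -1, whence q^(-1/2), and the flip returns it to v_1 (x) v_0. *)
Lemma braid_delta (k l : 'I_2) :
  braiding (V0 R) (V0 R) *m (delta_mx k (0 : 'I_1) *t (delta_mx l 0 : 'cV[C]_2)) =
  qpow (wt k * wt l / 2%:R) *: (delta_mx l 0 *t delta_mx k (0 : 'I_1))
  + ((k == 1) && (l == 0))%:R * qbrace 1 * qpow (- (1 / 2%:R)) *:
    (delta_mx 1 0 *t (delta_mx 0 0 : 'cV[C]_2)).
Proof.
have wtH (j : 'I_2) : uH (V0 R) *m (delta_mx j 0 : 'cV_2) = wt j *: delta_mx j 0.
  rewrite /= mul_diag_mx; apply/matrixP => i c; rewrite !mxE.
  by case: eqP => [->|]; rewrite ?mulr0.
(* Vectors are matrices with one column, so naturality of the flip leaves on the right the flip of a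
   one-dimensional tensor product. *)
have flip1 : flipmx R 1 1 = 1%:M.
  by apply/matrixP => i j; rewrite !mxE !ord1 eqxx.
rewrite /braiding /Rmx -!mulmxA mulmxDl mul1mx -scalemxAl tensmx_mul mulmxDr.
rewrite (qHHP (wtH k) (wtH l)) mulmxDr -scalemxAr flipmxE flip1 mulmx1; congr (_ + _).
rewrite /= !mul_delta_mx_cond; elim/ord2_ind: k => /=.
  by rewrite mulr0n tens0mx scaler0 !mulmx0 !mul0r scale0r.
elim/ord2_ind: l => /=; last by rewrite mulr0n tensmx0 scaler0 !mulmx0 !mul0r scale0r.
rewrite !mulr1n -!scalemxAr (qHHP (wtH 0) (wtH 1)) -scalemxAr flipmxE flip1 mulmx1.
by rewrite scalerA !wtE /= !mul1r mulNr mul1r.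
Qed.

Lemma braid_entry (B : 'M[C]_(2 * 2)) (i j k l : 'I_2) :
  B (mxtens_index (k, l)) (mxtens_index (i, j)) =
  (B *m (delta_mx i (0 : 'I_1) *t delta_mx j (0 : 'I_1))) (mxtens_index (k, l)) (mxtens_index (0, 0)).
Proof.
rewrite mxE (bigD1 (mxtens_index (i, j))) //= big1 => [|r].
  by rewrite tensmxE !mxE !eqxx !mulr1 addr0.
case: (mxtens_indexP r) => a b nr; rewrite tensmxE !mxE !eqxx !andbT -natrM mulnb.
by move: nr; rewrite (can_eq (@mxtens_indexK _ _)) xpair_eqE => /negPf->; rewrite mulr0.
Qed.

(** The cast only re-brackets the index triple, hence is invisible on the vectors v_i (x) v_j (x)
    x. *)
Lemma cast_tens_tcol d (B : 'M[C]_(2 * 2)) (i j : 'I_2) :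
  castmx (esym (mulnA _ _ _), esym (mulnA _ _ _)) (B *t (1%:M : 'M[C]_d)) *m
    (tcol C (2 * d) i *m tcol C d j) =
  \sum_k \sum_l B (mxtens_index (k, l)) (mxtens_index (i, j)) *:
    (tcol C (2 * d) k *m tcol C d l).
Proof.
have idxA (a : 'I_2) (b : 'I_2) (r : 'I_d) :
    cast_ord (mulnA 2 2 d) (mxtens_index (a, mxtens_index (b, r)))
    = mxtens_index (mxtens_index (a, b), r).
  by apply: val_inj; rewrite /= mulnDl addnA mulnA.
apply/matrixP => x r; rewrite mulmxA !mul_tcol castmxE !esymK idxA summxE.
case: (mxtens_indexP x) => a x'; case: (mxtens_indexP x') => b y {x x'}.
rewrite idxA tensmxE (bigD1 a) //= summxE (bigD1 b) //= !big1 ?addr0.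
- rewrite [RHS]mxE mul_tcol; congr (_ * _).
  by rewrite !mxE; do 2!rewrite (can_eq (@mxtens_indexK _ _)) xpair_eqE eqxx /=.
- move=> k nk; rewrite summxE big1 // => l _.
  rewrite [LHS]mxE mul_tcol mxE !(can_eq (@mxtens_indexK _ _)) xpair_eqE eq_sym (negPf nk).
  by rewrite mulr0.
- move=> l nl.
  rewrite [LHS]mxE mul_tcol mxE !(can_eq (@mxtens_indexK _ _)) xpair_eqE eqxx /=.
  by rewrite (can_eq (@mxtens_indexK _ _)) xpair_eqE eq_sym (negPf nl) mulr0.
Qed.

(** Compared on the four v_i (x) v_j. The vector b^T kills those with i = j, where both sides
    multiply by s = q^(1/2). On the other two, q^(-1/2) = -i s and {1} q^(-1/2) = 2 s reproduce 1 +
    b b^T. *)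
Lemma cast_braidingE d :
  castmx (esym (mulnA _ _ _), esym (mulnA _ _ _)) (braiding (V0 R) (V0 R) *t (1%:M : 'M[C]_d))
  = qpow (1 / 2%:R) *: (1%:M + ucup d *m (ucup d)^T).
Proof.
apply: tcol_inj => i; apply: tcol_inj => j; rewrite -!mulmxA cast_tens_tcol.
rewrite -scalemxAl mulmxDl mul1mx.
under eq_bigr => k _ do under eq_bigr => l _ do rewrite braid_entry braid_delta.
rewrite !big_ord2.
elim/ord2_ind: i; elim/ord2_ind: j; rewrite !wtE !(mxE, tensmxE) /= -!mulmxA !capE
  ?cap_tcol0 ?cap_tcol1.
all: rewrite ?(mulr0, mul0r, mulr1, mul1r, add0r, addr0, scale0r, mulN1r, mulNr, mulrN1) ?opprK.
all: rewrite // -[2^-1]mul1r qpowN_half ?qbrace1 /ucup.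
all: rewrite -?[tcol R[i] _ _]/(tcol C _ _).
all: set x := c0 _ *m c1 _; set y := c1 _ *m c0 _; move: x y => x y.
all: apply/matrixP => ? ?; rewrite !mxE; ring: mul_ii.
Qed.
End V0tens.

(** * Temperley-Lieb operators and the braid relations *)

Section Representation.
Variable R : realType.
Local Notation C := R[i].
Local Notation I := ('i : C).
Local Notation V := (V0 R).

Lemma tens_cup c d (M : 'M[C]_(c, d)) :
  (1%:M *t (1%:M *t M)) *m ucup R d = ucup R c *m M.
Proof.
rewrite /ucup mulmxBr mulmxBl -scalemxAr -scalemxAl !mulmxA tens1_c0 tens1_c1.
by rewrite -!mulmxA tens1_c0 tens1_c1.
Qed.

Lemma cap_tens c d (M : 'M[C]_(c, d)) :
  (ucup R c)^T *m (1%:M *t (1%:M *t M)) = M *m (ucup R d)^T.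
Proof.
by apply: trmx_inj; rewrite !trmx_mul !trmx_tens !trmx1 !trmxK tens_cup.
Qed.

(** e_i, and 0 unless i + 1 < m. *)
Fixpoint tl_mx m i {struct m} : 'M[C]_(udim (upow V m)) :=
  match m return 'M[C]_(udim (upow V m)) with
  | 0 => 0
  | m1.+1 =>
    match i with
    | i'.+1 => 1%:M *t tl_mx m1 i'
    | 0 =>
      match m1 return 'M[C]_(udim (upow V m1.+1)) with
      | 0 => 0
      | m2.+1 => ucup R (udim (upow V m2)) *m (ucup R (udim (upow V m2)))^T
      end
    end
  end.

Lemma braiding_atE m i : (i.+1 < m)%N ->
  braiding_at V m i = qpow (1 / 2%:R) *: (1%:M + tl_mx m i).
Proof.
elim: m i => [//|m IH] [|i] /= lt_im; last by rewrite IH // tensmxZr tensmxDr tensmx11.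
by case: m {IH} lt_im => [//|m] _; exact: cast_braidingE.
Qed.

Lemma tl_sq m i : tl_mx m i *m tl_mx m i = 0.
Proof.
elim: m i => [|m IH] [|i] /=; rewrite ?mul0mx //; last by rewrite tensmx_mul IH tensmx0.
case: m {IH} => [|m]; rewrite ?mul0mx // mulmxA -(mulmxA (ucup _ _)) cap_cup.
by rewrite mulmx0 mul0mx.
Qed.

(** In the head case the operator at position j >= 2 has the form 1 (x) 1 (x) M, and M slides
    through the cup and the cap of e_0. *)
Lemma tl_far m i j : (i.+1 < j)%N -> tl_mx m i *m tl_mx m j = tl_mx m j *m tl_mx m i.
Proof.
elim: m i j => [|m IH] [|i] [|j] //= lt_ij; rewrite ?mul0mx ?mulmx0 //; last first.
  by rewrite !tensmx_mul IH.
case: m {IH} => [|m]; rewrite ?mul0mx ?mulmx0 //.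
case: j lt_ij => [//|j] _ /=.
by rewrite -mulmxA cap_tens !mulmxA tens_cup.
Qed.

Lemma tens_capcup d : (1%:M : 'M[C]_2) *t (ucup R d *m (ucup R d)^T) =
  (1%:M *t ucup R d) *m (1%:M *t ucup R d)^T.
Proof. by rewrite trmx_tens trmx1 tensmx_mul mulmx1. Qed.

Lemma tens_cap_cup d : ((1%:M : 'M[C]_2) *t ucup R d)^T *m ucup R (2 * d) = - I *: 1%:M.
Proof. by apply: trmx_inj; rewrite trmx_mul trmxK cap_tens_cup linearZ /= trmx1. Qed.

(** In the head case e_0 and e_1 factor as a cup after a cap; the caps and cups that meet in e_0 e_1
    e_0 form two zigzags. *)
Lemma tl_braid1 m i : (i.+2 < m)%N -> tl_mx m i *m tl_mx m i.+1 *m tl_mx m i = - tl_mx m i.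
Proof.
elim: m i => [//|m IH] [|i] lt_im; last first.
  by rewrite [LHS]/= !tensmx_mul !mul1mx IH // tensmxNr.
case: m {IH} lt_im => [//|[//|m]] _ /=.
set d := udim (upow V m).
rewrite (tens_capcup d) !mulmxA -(mulmxA (ucup _ _)) (cap_tens_cup R d) -!mulmxA.
rewrite (mulmxA (1%:M *t _)^T) (tens_cap_cup d).
by rewrite -!scalemxAl -!scalemxAr !scalerA !mul1mx mulrNN mul_ii scaleN1r.
Qed.

Lemma tl_braid2 m i : (i.+2 < m)%N -> tl_mx m i.+1 *m tl_mx m i *m tl_mx m i.+1 = - tl_mx m i.+1.
Proof.
elim: m i => [//|m IH] [|i] lt_im; last first.
  by rewrite [LHS]/= !tensmx_mul !mul1mx IH // tensmxNr.
case: m {IH} lt_im => [//|[//|m]] _ /=.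
set d := udim (upow V m).
rewrite (tens_capcup d) -!mulmxA (mulmxA (1%:M *t _)^T (ucup _ _)) (tens_cap_cup d).
rewrite (mulmxA (ucup _ _)^T) (cap_tens_cup R d).
by rewrite -!scalemxAl -!scalemxAr !scalerA !mul1mx mulrNN mul_ii scaleN1r.
Qed.

Definition ucommute (W : umodule R) (M : 'M[C]_(udim W)) :=
  [/\ uE W *m M = M *m uE W, uF W *m M = M *m uF W,
      uK W *m M = M *m uK W & uH W *m M = M *m uH W].

Lemma ucommute_cupcap (W : umodule R) :
  @ucommute (utens V (utens V W)) (ucup R (udim W) *m (ucup R (udim W))^T).
Proof.
split.
- by rewrite mulmxA uE_cup -mulmxA -uE_cap mulmxA.
- by rewrite mulmxA uF_cup -mulmxA -uF_cap mulmxA.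
- by rewrite mulmxA uK_cup -mulmxA -uK_cap mulmxA.
- by rewrite mulmxA uH_cup -mulmxA -uH_cap mulmxA.
Qed.

Lemma ucommute_tens (W : umodule R) (M : 'M[C]_(udim W)) :
  ucommute M -> @ucommute (utens V W) (1%:M *t M).
Proof.
move=> [cE cF cK cH]; split.
- by rewrite mulmxDl mulmxDr !tensmx_mul !mul1mx !mulmx1 cE cK.
- by rewrite mulmxDl mulmxDr !tensmx_mul !mul1mx !mulmx1 cF.
- by rewrite !tensmx_mul mul1mx mulmx1 cK.
- by rewrite mulmxDl mulmxDr !tensmx_mul !mul1mx !mulmx1 cH.
Qed.

Lemma ucommute0 (W : umodule R) : @ucommute W 0.
Proof. by split; rewrite mul0mx mulmx0. Qed.

Lemma tl_comm m i : ucommute (tl_mx m i).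
Proof.
elim: m i => [|m IH] [|i].
- exact: ucommute0.
- exact: ucommute0.
- case: m {IH} => [|m]; first exact: ucommute0.
  exact: (ucommute_cupcap (upow V m)).
- exact: (ucommute_tens (IH i)).
Qed.

Lemma qpow_half_sq : qpow (1 / 2%:R : C) ^+ 2 = I.
Proof. by rewrite expr2 -qpowD -mulrDl -mulr2n divff ?pnatr_eq0 // qpow1. Qed.

Section Words.
Variable m : nat.
Local Notation s := (qpow (1 / 2%:R) : C).
Local Notation word := (braid_word m).

(** Since e_i^2 = 0, the inverse of s (1 + e_i) is s^-1 (1 - e_i). *)
Definition letter_mx (x : 'I_m.-1 * bool) : 'M[C]_(udim (upow V m)) :=
  if x.2 then s^-1 *: (1%:M - tl_mx m x.1) else s *: (1%:M + tl_mx m x.1).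

Definition word_mx (w : word) := foldr (fun x M => letter_mx x *m M) 1%:M w.

Lemma word_mx_cat u v : word_mx (u ++ v) = word_mx u *m word_mx v.
Proof. by elim: u => [|x u IH] /=; rewrite ?mul1mx // IH mulmxA. Qed.

Lemma far_comm d (t : C) (a b : 'M[C]_d) : a *m b = b *m a ->
  (t *: (1%:M + a)) *m (t *: (1%:M + b)) = (t *: (1%:M + b)) *m (t *: (1%:M + a)).
Proof.
move=> ab; rewrite -!scalemxAl -!scalemxAr; congr (_ *: (_ *: _)).
by rewrite !mulmxDr !mulmxDl !mul1mx !mulmx1 ab -!addrA (addrCA a).
Qed.

(** In (1 + a)(1 + b)(1 + a) the term aba = -a cancels one of the two copies of a, leaving 1 + a + b
    + ab + ba, which is symmetric in a and b. *)
Lemma yang_baxter d (t : C) (a b : 'M[C]_d) :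
  a *m a = 0 -> b *m b = 0 -> a *m b *m a = - a -> b *m a *m b = - b ->
  (t *: (1%:M + a)) *m ((t *: (1%:M + b)) *m (t *: (1%:M + a))) =
  (t *: (1%:M + b)) *m ((t *: (1%:M + a)) *m (t *: (1%:M + b))).
Proof.
move=> a2 b2 aba bab.
have e : (1%:M + a) *m ((1%:M + b) *m (1%:M + a)) = (1%:M + b) *m ((1%:M + a) *m (1%:M + b)).
  rewrite !(mulmxDr, mulmxDl, mulmx1, mul1mx) !mulmxA a2 b2 aba bab.
  move: (a *m b) (b *m a) => ab ba.
  by apply/matrixP => x y; rewrite !mxE; ring.
by rewrite -!scalemxAl -!scalemxAr e.
Qed.

(** Makes [word_mx] well defined on the braid group, one defining relation at a time. *)
Lemma braid_eq_mx u v : braid_eq u v -> word_mx u = word_mx v.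
Proof.
have s0 : s != 0 by rewrite -unitfE qpow_unit.
elim=> {u v} [//|u v _ -> //|u v w _ -> _ -> //|u u' v v' _ eu _ ev|i b|i j lt_ij|i j ij].
- by rewrite !word_mx_cat eu ev.
- rewrite /= mulmx1 /letter_mx /=; case: b; rewrite /= -scalemxAl -scalemxAr scalerA.
    by rewrite mulVf // scale1r mulmxDr mulmx1 mulmxBl mul1mx tl_sq subr0 subrK.
  by rewrite mulfV // scale1r mulmxBr mulmx1 mulmxDl mul1mx tl_sq addr0 addrK.
- by rewrite /word_mx /= !mulmx1; apply/far_comm/tl_far.
have lt_jm : (i.+2 < m)%N by move: (ltn_ord j); rewrite ij ltn_predRL.
rewrite /word_mx /= !mulmx1 /letter_mx /= ij.
by apply: yang_baxter; rewrite ?tl_sq ?tl_braid1 ?tl_braid2.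
Qed.
End Words.
End Representation.

(** * The swap X and the invariance of the pairing x^* X y *)

Section Flip.
Variable R : realType.
Local Notation C := R[i].
Local Notation I := ('i : C).
Local Notation V := (V0 R).
Local Notation adj M := (map_mx Num.conj M^T).

Lemma adj_mul m n p (A : 'M[C]_(m, n)) (B : 'M[C]_(n, p)) : adj (A *m B) = adj B *m adj A.
Proof. by rewrite trmx_mul map_mxM. Qed.
Lemma adj_tens m n p q (A : 'M[C]_(m, n)) (B : 'M[C]_(p, q)) : adj (A *t B) = adj A *t adj B.
Proof. by rewrite trmx_tens map_mxT. Qed.
Lemma adj_add m n (A B : 'M[C]_(m, n)) : adj (A + B) = adj A + adj B.
Proof. by rewrite linearD map_mxD. Qed.
Lemma adj_sub m n (A B : 'M[C]_(m, n)) : adj (A - B) = adj A - adj B.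
Proof. by rewrite linearB map_mxB. Qed.
Lemma adj_scale m n a (A : 'M[C]_(m, n)) : adj (a *: A) = a^* *: adj A.
Proof. by rewrite linearZ map_mxZ. Qed.
Lemma adj_adj m n (A : 'M[C]_(m, n)) : adj (adj A) = A.
Proof. by apply/matrixP => i j; rewrite !mxE conjCK. Qed.
Lemma adj1 n : adj (1%:M : 'M[C]_n) = 1%:M.
Proof. by rewrite trmx1 map_mx1. Qed.
Lemma adj0 m n : adj (0 : 'M[C]_(m, n)) = 0.
Proof. by rewrite trmx0 map_mx0. Qed.
Lemma adj_delta m n i j : adj (delta_mx i j : 'M[C]_(m, n)) = delta_mx j i.
Proof. by rewrite trmx_delta map_delta_mx. Qed.

Lemma conjNi : (- I)^* = I.
Proof. by rewrite rmorphN /= conjCi opprK. Qed.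

Lemma uK_V0 : uK V = I *: delta_mx 0 0 - I *: delta_mx 1 1.
Proof.
apply/matrixP; elim/ord2_ind; elim/ord2_ind; rewrite [LHS]mxE !mxE /=
  ?mulr0 ?mulr1 ?mulr0n ?mulr1n ?subr0 ?sub0r ?oppr0 //.
  by rewrite expr0 qpow1.
by rewrite expr1 qpowN1.
Qed.

Lemma uH_V0 : uH V = delta_mx 0 0 - delta_mx 1 1.
Proof.
by apply/matrixP; elim/ord2_ind; elim/ord2_ind; rewrite [LHS]mxE !mxE /=
  ?mulr0n ?mulr1n ?subr0 ?sub0r ?oppr0.
Qed.

Lemma mulmx_delta2 m n (i : 'I_m) (j : 'I_n) (a b : 'I_2) :
  (delta_mx i a : 'M[C]_(m, 2)) *m (delta_mx b j : 'M[C]_(2, n)) =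
  if a == b then delta_mx i j else 0.
Proof. by rewrite mul_delta_mx_cond; case: eqP. Qed.

Lemma one_delta : (1%:M : 'M[C]_2) = delta_mx 0 0 + delta_mx 1 1.
Proof. by rewrite mx1_sum_delta big_ord2. Qed.

Definition flip2 : 'M[C]_2 := delta_mx 0 1 + delta_mx 1 0.

Fixpoint flip_pow m : 'M[C]_(udim (upow V m)) :=
  match m return 'M[C]_(udim (upow V m)) with
  | 0 => 1%:M
  | m'.+1 => flip2 *t flip_pow m'
  end.

Lemma flip2_sq : flip2 *m flip2 = 1%:M.
Proof.
by apply/matrixP; elim/ord2_ind; elim/ord2_ind; rewrite !mxE big_ord2 !mxE /=
  ?(mulr0, mul0r, addr0, add0r, mulr1).
Qed.

Lemma flip_pow_sq m : flip_pow m *m flip_pow m = 1%:M.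
Proof. by elim: m => [|m IH]; rewrite ?mulmx1 //= tensmx_mul IH flip2_sq tensmx11. Qed.

Lemma adj_flip2 : adj flip2 = flip2.
Proof. by rewrite /flip2 adj_add !adj_delta addrC. Qed.

Lemma adj_flip_pow m : adj (flip_pow m) = flip_pow m.
Proof. by elim: m => [|m IH]; rewrite /= ?adj1 // adj_tens IH adj_flip2. Qed.

(** The first three clauses say that E, F and K are self-adjoint for the pairing x^* X y; the last
    says that X exchanges the weights l and -l. *)
Definition dualizes (W : umodule R) (X : 'M[C]_(udim W)) :=
  [/\ adj (uE W) *m X = X *m uE W, adj (uF W) *m X = X *m uF W,
    adj (uK W) *m X = X *m uK W & uH W *m X = - (X *m uH W)].

Local Ltac delta2 := rewrite /flip2 !(mulmxDl, mulmxDr, mulmxN, mulNmx, =^~ scalemxAl,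
  =^~ scalemxAr, mulmx_delta2) /= ?(scaler0, addr0, add0r, oppr0).

Lemma dualizes_V0 : @dualizes V flip2.
Proof.
split; rewrite ?adj_delta ?uK_V0 ?uH_V0 ?adj_sub ?adj_scale ?adj_delta ?conjCi.
- by rewrite ?adj_delta; delta2.
- by delta2.
- by delta2; rewrite !scaleNr opprK addrC.
- by delta2; rewrite opprD opprK addrC.
Qed.

Lemma dualizes_invK (W : umodule R) (X : 'M[C]_(udim W)) :
  dualizes X -> adj (invmx (uK W)) *m X = X *m invmx (uK W).
Proof.
move=> [_ _ XK _]; apply: (canRL (mulmxK (uK_unit W))).
have -> : adj (invmx (uK W)) *m X *m uK W = adj (uK W *m invmx (uK W)) *m X.
  by rewrite -mulmxA -XK mulmxA -adj_mul.
by rewrite mulmxV ?uK_unit // adj1 mul1mx.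
Qed.

(** The coproducts of E, F and K are sums of tensor products of operators that are self-adjoint on
    each factor, K^-1 included. *)
Lemma dualizes_tens (W : umodule R) (X : 'M[C]_(udim W)) :
  dualizes X -> @dualizes (utens V W) (flip2 *t X).
Proof.
move=> dX; have XiK := dualizes_invK dX; case: dX => XE XF XK XH.
have [VE VF VK VH] := dualizes_V0.
have ViK : adj (invmx (uK V)) *m flip2 = flip2 *m invmx (uK V).
  by rewrite invK_V0 adj_add !adj_scale !adj_delta conjNi conjCi; delta2; rewrite addrC.
split.
- by rewrite adj_add mulmxDl mulmxDr !adj_tens !tensmx_mul adj1 mul1mx mulmx1 XE VE XK.
- by rewrite adj_add mulmxDl mulmxDr !adj_tens !tensmx_mul adj1 mul1mx mulmx1 XF VF ViK.
- by rewrite adj_tens !tensmx_mul XK VK.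
- by rewrite mulmxDl mulmxDr !tensmx_mul !mul1mx !mulmx1 XH VH tensmxNl tensmxNr opprD.
Qed.

Lemma dualizes_flip_pow m : dualizes (flip_pow m).
Proof.
elim: m => [|m IH]; last exact: (dualizes_tens IH).
by split; rewrite /= ?adj0 ?adj1 ?mulmx0 ?mul0mx ?mulmx1 ?mul1mx ?oppr0.
Qed.

(** Swapping v_0 and v_1 turns b into v_0 (x) v_1 - i v_1 (x) v_0, which is -i times the complex
    conjugate of b. *)
Lemma flip_tens_cup d (X : 'M[C]_d) :
  (flip2 *t (flip2 *t X)) *m ucup R d = - I *: (map_mx Num.conj (ucup R d) *m X).
Proof.
have f0 c e (M : 'M[C]_(c, e)) : (flip2 *t M) *m tcol C e 0 = tcol C c 1 *m M.
  by rewrite tens_tcol big_ord2 !mxE /= !(scale1r, scale0r, addr0, add0r).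
have f1 c e (M : 'M[C]_(c, e)) : (flip2 *t M) *m tcol C e 1 = tcol C c 0 *m M.
  by rewrite tens_tcol big_ord2 !mxE /= !(scale1r, scale0r, addr0, add0r).
have tr n e (j : 'I_n) : map_mx Num.conj (tcol C e j) = tcol C e j.
  by apply/matrixP => a b; rewrite !mxE rmorph_nat.
rewrite /ucup map_mxB map_mxZ !map_mxM !tr /= conjCi !scaleNr opprK.
rewrite mulmxBr -scalemxAr !mulmxA f0 f1 -!mulmxA f0 f1.
by rewrite mulmxDl -scalemxAl -!mulmxA scalerDr scalerA mul_ii scaleN1r opprB.
Qed.

(** In the head case X e_0 is -i times the Hermitian matrix B' Y B^T, with B the cup, B' its
    conjugate and Y the swap on the remaining factors. So X e_0 is anti-Hermitian, while X is
    Hermitian. *)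
Lemma adj_tl_mx_flip m i : adj (tl_mx R m i) *m flip_pow m = - (flip_pow m *m tl_mx R m i).
Proof.
have base d (X : 'M[C]_d) : adj X = X ->
    let f := flip2 *t (flip2 *t X) in let t := ucup R d *m (ucup R d)^T in
    adj t *m f = - (f *m t).
  move=> Xadj f t.
  have fa : adj f = f by rewrite /f !adj_tens adj_flip2 Xadj.
  have -> : adj t *m f = adj (f *m t) by rewrite [RHS]adj_mul fa.
  rewrite /t mulmxA flip_tens_cup -scalemxAl adj_scale !adj_mul.
  rewrite conjNi Xadj scaleNr opprK.
  have -> : adj (map_mx Num.conj (ucup R d)) = (ucup R d)^T.
    by apply/matrixP => a b; rewrite !mxE conjCK.
  by rewrite trmxK mulmxA.
have zero n (X : 'M[C]_n) : adj 0 *m X = - (X *m 0) by rewrite adj0 mul0mx mulmx0 oppr0.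
elim: m i => [|m IH] [|i]; [exact: zero | exact: zero | |].
  case: m {IH} => [|m]; first exact: zero.
  exact: (base _ _ (adj_flip_pow m)).
by rewrite /= adj_tens !tensmx_mul adj1 mul1mx mulmx1 IH tensmxNr.
Qed.

(** Here |s|^2 = |s^2| = |i| = 1. *)
Lemma qpow_half_unit : qpow (1 / 2%:R : C) * (qpow (1 / 2%:R))^* = 1.
Proof.
by rewrite -normCK -normrX qpow_half_sq normCi.
Qed.

(** With |a| = 1, moving the adjoint of a (1 + t) across X gives X (1 - t)(1 + t) = X (1 - t^2) =
    X. *)
Lemma letter_unitary m x :
  adj (letter_mx R x) *m flip_pow m *m letter_mx R x = flip_pow m.
Proof.
have s0 : qpow (1 / 2%:R : C) != 0 by rewrite -unitfE qpow_unit.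
have key a (t : 'M[C]_(udim (upow V m))) : a * a^* = 1 ->
    adj t *m flip_pow m = - (flip_pow m *m t) -> t *m t = 0 ->
    adj (a *: (1%:M + t)) *m flip_pow m *m (a *: (1%:M + t)) = flip_pow m.
  move=> a1 tf t2; rewrite adj_scale adj_add adj1 -!scalemxAl -scalemxAr scalerA mulrC a1 scale1r.
  rewrite mulmxDl mul1mx tf mulmxDr mulmx1 mulmxBl -mulmxA t2 mulmx0 subr0.
  exact: subrK.
rewrite /letter_mx; case: x.2.
  apply: key; rewrite ?mulNmx ?mulmxN ?tl_sq ?oppr0 //.
    by rewrite fmorphV -invfM qpow_half_unit invr1.
  by rewrite linearN map_mxN mulNmx adj_tl_mx_flip.
by apply: key; rewrite ?tl_sq ?qpow_half_unit // adj_tl_mx_flip.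
Qed.

Lemma word_unitary m (w : braid_word m) :
  adj (word_mx R w) *m flip_pow m *m word_mx R w = flip_pow m.
Proof.
elim: w => [|x w IH] /=; first by rewrite adj1 mul1mx mulmx1.
by rewrite adj_mul !mulmxA -(mulmxA _ (adj _)) -(mulmxA _ _ (letter_mx R x)) letter_unitary.
Qed.
End Flip.

(** * Highest weight vectors, the Hermitian form on morphisms and an isotropic vector *)

Section HighestWeight.
Variable R : realType.
Local Notation C := R[i].
Local Notation I := ('i : C).
Local Notation V := (V0 R).
Local Notation adj M := (map_mx Num.conj M^T).

Section Module.
Variable W : umodule R.
Local Notation d := (udim W).
Implicit Type u : 'cV[C]_d.

(** As q^(2l) = -1, K^-1 acts on u as -q^l, so K - K^-1 acts as 2 q^l, while q - q^-1 = 2i. For l =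
    1 and l = -1 this makes [E, F] act as 1 and -1. *)
Lemma uEF_weight (l : C) u : qpow l * qpow l = -1 -> uH W *m u = l *: u ->
  uE W *m (uF W *m u) - uF W *m (uE W *m u) = (qpow l / I) *: u.
Proof.
move=> ll Hu; have Ku := uK_qH Hu.
have Kiu : invmx (uK W) *m u = - qpow l *: u.
  apply: (can_inj (mulKmx (uK_unit W))); rewrite mulKVmx ?uK_unit //.
  by rewrite -scalemxAr Ku scalerA mulNr ll opprK scale1r.
rewrite !mulmxA -mulmxBl uEF -scalemxAl mulmxBl Ku Kiu scaleNr opprK -scalerDl scalerA.
congr (_ *: _); rewrite [qq R]qpow1 inv_i opprK; move: (qpow l) => x.
by rewrite -[I + I]mulr2n -[x + x]mulr2n -mulr_natr -[x *+ 2]mulr_natr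
  invfM mulrACA mulVf ?pnatr_eq0 // mulr1 mulrC inv_i.
Qed.

Lemma uEF_weight1 u : uH W *m u = u -> uE W *m (uF W *m u) = u + uF W *m (uE W *m u).
Proof.
move=> Hu; rewrite -[X in X + _]scale1r.
have -> : 1 = qpow 1 / I by rewrite qpow1 mulfV ?neq0Ci.
by rewrite -uEF_weight ?subrK ?scale1r // qpow1 mul_ii.
Qed.

Lemma uFE_weightN1 u : uH W *m u = - u -> uF W *m (uE W *m u) = u + uE W *m (uF W *m u).
Proof.
move=> Hu; rewrite -[X in X + _]opprK -[X in - X + _]scaleN1r.
have -> : -1 = qpow (-1) / I by rewrite qpowN1 mulNr mulfV ?neq0Ci.
rewrite -uEF_weight ?scaleN1r ?qpowN1 ?mulrNN ?mul_ii //.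
by rewrite opprB subrK.
Qed.

Definition hw_vector u := uE W *m u = 0 /\ uH W *m u = u.

Definition hw_hom u : 'M[C]_(d, 2) :=
  u *m delta_mx 0 0 + uF W *m u *m delta_mx 0 1.

Lemma hw_hom0 u : hw_hom u *m delta_mx 0 (0 : 'I_1) = u.
Proof.
rewrite mulmxDl -!mulmxA !mulmx_delta2 /= !mulmx0 addr0.
by rewrite (_ : delta_mx 0 0 = 1%:M) ?mulmx1 //; apply/matrixP => i j; rewrite !ord1 !mxE.
Qed.

Lemma hw_hom1 u : hw_hom u *m delta_mx 1 (0 : 'I_1) = uF W *m u.
Proof.
rewrite mulmxDl -!mulmxA !mulmx_delta2 /= !mulmx0 add0r.
by rewrite (_ : delta_mx 0 0 = 1%:M) ?mulmx1 //; apply/matrixP => i j; rewrite !ord1 !mxE.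
Qed.

Lemma uHF_weight u : uH W *m u = u -> uH W *m (uF W *m u) = - (uF W *m u).
Proof.
move=> Hu; have := uHF W; move/(congr1 (mulmx^~ u)) => /=.
rewrite mulmxBl -!mulmxA Hu -scalemxAl => /(canRL (subrK _)) ->.
rewrite -{2}[uF W *m u]scale1r -scalerDl -[RHS]scaleN1r; congr (_ *: _); ring.
Qed.

(** Compatibility with E v_1 = v_0 requires E F u = u, which holds because [E, F] acts as 1 in
    weight 1 and E u = 0; F v_1 = 0 corresponds to F^2 = 0. *)
Lemma hw_hom_in u : hw_vector u -> hw_hom u \in uhom V W.
Proof.
move=> [Eu Hu].
have HFu := uHF_weight Hu.
have Ku : uK W *m u = I *: u by rewrite -qpow1; apply: uK_qH; rewrite scale1r.
have KFu : uK W *m (uF W *m u) = - I *: (uF W *m u).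
  by rewrite -qpowN1; apply: uK_qH; rewrite scaleN1r.
have EFu : uE W *m (uF W *m u) = u by rewrite uEF_weight1 // Eu mulmx0 addr0.
have FFu : uF W *m (uF W *m u) = 0 by rewrite mulmxA uF2 mul0mx.
apply/uhomP; split; rewrite /hw_hom mulmxDr mulmxDl [LHS](congr2 _ (mulmxA _ _ _) (mulmxA _ _ _)).
- by rewrite Eu EFu mul0mx -!mulmxA !mulmx_delta2 /= !mulmx0 addr0 add0r.
- by rewrite FFu mul0mx -!mulmxA !mulmx_delta2 /= !mulmx0 addr0 add0r.
- rewrite Ku KFu uK_V0 -!mulmxA !mulmxBr -!scalemxAr !mulmx_delta2 /=.
  by rewrite !mulmx0 !scaler0 subr0 sub0r -!scalemxAl scaleNr mulmxA.
- rewrite Hu HFu uH_V0 -!mulmxA !mulmxBr !mulmx_delta2 /=.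
  by rewrite !mulmx0 subr0 sub0r mulNmx mulmxA.
Qed.

Lemma hw_of_hom (f : 'M[C]_(d, 2)) : f \in uhom V W ->
  hw_vector (f *m delta_mx 0 (0 : 'I_1)) /\ f = hw_hom (f *m delta_mx 0 0).
Proof.
move=> /uhomP[Ef Ff _ Hf]; split; first split.
- by rewrite mulmxA Ef -mulmxA mulmx_delta2 mulmx0.
- by rewrite mulmxA Hf -mulmxA uH_V0 mulmxBl !mulmx_delta2 subr0.
have FV : uF V *m (delta_mx 0 0 : 'cV[C]_2) = delta_mx 1 0 by exact: mul_delta_mx.
rewrite /hw_hom (mulmxA (uF W)) Ff -!mulmxA (mulmxA (uF V)) FV !mul_delta_mx.
by rewrite -mulmxDr -one_delta mulmx1.
Qed.
End Module.

(** (g v_0)^* X (f v_1), see [hform_col]. *)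
Definition hform m (f g : 'M[C]_(udim (upow V m), 2)) := (adj g *m flip_pow R m *m f) 0 1.

Section Form.
Variable m : nat.
Local Notation W := (upow V m).
Local Notation X := (flip_pow R m).
Implicit Types f g : 'M[C]_(udim W, 2).

Lemma hform_herm f g : f \in uhom V W -> g \in uhom V W -> hform f g = (hform g f)^*.
Proof.
move=> /uhomP[Ef _ _ _] /uhomP[Eg _ _ _].
have [XE _ _ _] := dualizes_flip_pow R m.
have -> : (hform g f)^* = (adj g *m X *m f) 1 0.
  have <- : adj (adj f *m X *m g) = adj g *m X *m f.
    by rewrite !adj_mul adj_adj adj_flip_pow mulmxA.
  by rewrite [RHS]mxE; congr (_^*); rewrite [RHS]mxE.
(* Self-adjointness of E makes A = g^* X f satisfy A E = E^* A; the entry (1, 1) of this equation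
   reads A_10 = A_01. *)
have /matrixP/(_ 1 1) : (adj g *m X *m f) *m uE V = adj (uE V) *m (adj g *m X *m f).
  by rewrite !mulmxA -(adj_mul g) -Eg adj_mul -(mulmxA _ (adj _)) XE -!mulmxA Ef.
rewrite /= adj_delta /hform; move: (adj g *m X *m f) => A; rewrite !mxE !big_ord2 !mxE /=.
by rewrite !(mulr0, mul0r, addr0, add0r, mulr1, mul1r) => ->.
Qed.

Lemma hform_unitary (w : braid_word m) f g :
  hform (word_mx R w *m f) (word_mx R w *m g) = hform f g.
Proof. by rewrite /hform adj_mul -{2}(word_unitary R w) !mulmxA. Qed.

Lemma hform_col f g : hform f g =
  (adj (g *m delta_mx 0 (0 : 'I_1)) *m X *m (f *m delta_mx 1 (0 : 'I_1))) 0 0.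
Proof.
rewrite adj_mul adj_delta -!mulmxA -rowE mulmxA mulmxA -colE !mxE.
by rewrite /hform mxE.
Qed.

Lemma adj_mul_eq0 d (u : 'cV[C]_d) : (adj u *m u) 0 0 = 0 -> u = 0.
Proof.
rewrite mxE => /eqP; rewrite psumr_eq0 => [/allP u0|i _]; last first.
  by rewrite !mxE mulrC mul_conjC_ge0.
apply/matrixP => i j; rewrite ord1 [RHS]mxE; apply/eqP.
by have := u0 i (mem_index_enum _); rewrite !mxE mulrC mul_conjC_eq0.
Qed.

(** X u has weight -1, E raises it to weight 1, and E^2 = 0. *)
Lemma hw_vector_flip (u : 'cV[C]_(udim W)) : hw_vector u -> hw_vector (uE W *m (X *m u)).
Proof.
have [_ _ _ XH] := dualizes_flip_pow R m.
move=> [Eu Hu]; split; first by rewrite mulmxA uE2 mul0mx.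
have HE : uH W *m uE W = uE W *m uH W + 2%:R *: uE W by rewrite -uHE addrC subrK.
have HX : uH W *m (X *m u) = - (X *m u) by rewrite mulmxA XH mulNmx -mulmxA Hu.
rewrite mulmxA HE mulmxDl -mulmxA HX mulmxN -scalemxAl mulr2n scalerDl scale1r.
by rewrite addrA addNr add0r.
Qed.

Lemma hform_nondeg f : f \in uhom V W ->
  (forall g, g \in uhom V W -> hform g f = 0) -> f = 0.
Proof.
move=> /hw_of_hom[hu fE] f0; set u := f *m _ in hu fE.
have [XE XF _ XH] := dualizes_flip_pow R m.
have [Eu Hu] := hu.
suff u0 : u = 0 by rewrite fE u0 /hw_hom mulmx0 !mul0mx addr0.
apply: adj_mul_eq0; rewrite -(f0 _ (hw_hom_in (hw_vector_flip hu))).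
(* In weight -1, F E X u = X u + E F X u. Against u^* X the first term gives u^* u, and the second
   vanishes since X E = E^* X and E u = 0. *)
rewrite hform_col -/u hw_hom1 uFE_weightN1; last first.
  by rewrite mulmxA XH mulNmx -mulmxA Hu.
rewrite mulmxDr !mulmxA -(mulmxA (adj u)) flip_pow_sq mulmx1 -(mulmxA (adj u) X) -XE.
by rewrite mulmxA -adj_mul Eu adj0 !mul0mx addr0.
Qed.
End Form.

Definition isotropic_hw m := exists u : 'cV[C]_(udim (upow V m)),
  [/\ u != 0, hw_vector u & adj u *m flip_pow R m *m (uF (upow V m) *m u) = 0].

(** The component of b (x) u along v_1 (x) v_0 is u itself. *)
Lemma cup_inj d (u : 'cV[C]_d) : ucup R d *m u = 0 -> u = 0.
Proof.
move=> cu0.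
have : (tcol C d (0 : 'I_2))^T *m ((tcol C (2 * d) (1 : 'I_2))^T *m (ucup R d *m u)) = 0.
  by rewrite cu0 !mulmx0.
rewrite [ucup R d]/(_ - _) mulmxBl -scalemxAl mulmxBr -scalemxAr -!mulmxA tr_tcol11r tr_tcol10r.
by rewrite scaler0 subr0 tr_tcol00r.
Qed.

Lemma hw_cup (W : umodule R) (u : 'cV[C]_(udim W)) :
  hw_vector u -> @hw_vector (utens V (utens V W)) (ucup R (udim W) *m u).
Proof.
move=> [Eu Hu]; split.
  by rewrite mulmxA (uE_cup W) -mulmxA Eu mulmx0.
by rewrite mulmxA (uH_cup W) -mulmxA Hu.
Qed.

(** Starts from v_0 and puts a copy of b in front at each step. *)
Lemma hw_exists k : exists u : 'cV[C]_(udim (upow V k.*2.+1)), u != 0 /\ hw_vector u.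
Proof.
elim: k => [|k [u [u0 hu]]].
  exists (tcol C 1 (0 : 'I_2)); split; last split.
  - apply/eqP => /matrixP/(_ (mxtens_index (0, 0)) 0); rewrite !mxE eqxx => /eqP.
    by rewrite oner_eq0.
  - by rewrite (uE_tcol0 (uone R)) mulmx0.
  - by rewrite (uH_tcol0 (uone R)) mulmx0 add0r.
exists (ucup R (udim (upow V k.*2.+1)) *m u); split; last exact: hw_cup.
by apply: contra_neq u0; apply: cup_inj.
Qed.

(** F (b (x) u) = b (x) F u and X b is proportional to the conjugate of b, so the pairing has the
    factor conj(b^T b) = 0. *)
Lemma isotropic_cup m (u : 'cV[C]_(udim (upow V m))) :
  adj (ucup R _ *m u) *m flip_pow R m.+2 *m (uF (upow V m.+2) *m (ucup R _ *m u)) = 0.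
Proof.
have Fc : uF (upow V m.+2) *m ucup R (udim (upow V m)) =
    ucup R (udim (upow V m)) *m uF (upow V m).
  exact: uF_cup.
have Xc : flip_pow R m.+2 *m ucup R (udim (upow V m)) =
    - I *: (map_mx Num.conj (ucup R (udim (upow V m))) *m flip_pow R m).
  exact: flip_tens_cup.
have cc : adj (ucup R (udim (upow V m))) *m map_mx Num.conj (ucup R (udim (upow V m))) = 0.
  by rewrite -map_mxM cap_cup map_mx0.
rewrite (mulmxA (uF _)) Fc adj_mul -!mulmxA (mulmxA (flip_pow R m.+2)) Xc -scalemxAl -scalemxAr.
by rewrite -!mulmxA (mulmxA (adj (ucup R _))) cc !(mul0mx, mulmx0, scaler0).
Qed.

Lemma isotropic_exists k : isotropic_hw k.+1.*2.+1.
Proof.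
have [u [u0 hu]] := hw_exists k.
exists (ucup R (udim (upow V k.*2.+1)) *m u); split.
- by apply: contra_neq u0; apply: cup_inj.
- exact: hw_cup hu.
- exact: isotropic_cup.
Qed.

End HighestWeight.

(** * The dimension of the space of morphisms *)

Section Dimension.
Variable R : realType.
Local Notation C := R[i].
Local Notation I := ('i : C).
Local Notation V := (V0 R).
Local Notation c0 d := (tcol C d (0 : 'I_2)).
Local Notation c1 d := (tcol C d (1 : 'I_2)).

Section Lift.
Variable U : umodule R.
Local Notation d := (udim U).
Local Notation VU := (utens V U).

Definition hw_lift : 'M[C]_(2 * d, d) := c0 d + c1 d *m uE U.

(** E a has weight 2, where K = q^2 = -1; hence E (v_1 (x) E a) = - v_0 (x) E a cancels E (v_0 (x)
    a). *)
Lemma hw_lift_vector (a : 'cV[C]_d) : uH U *m a = 0 -> @hw_vector R VU (hw_lift *m a).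
Proof.
move=> Ha.
have HE : uH U *m (uE U *m a) = 2%:R *: (uE U *m a).
  rewrite mulmxA; have /(canRL (subrK _)) -> := uHE U.
  by rewrite mulmxDl -mulmxA Ha mulmx0 addr0 -scalemxAl.
have KE := uK_qH HE; rewrite qpow2 scaleN1r in KE.
rewrite /hw_lift mulmxDl -mulmxA; split.
  by rewrite mulmxDr uE_tcol0r uE_tcol1r KE (mulmxA (uE U)) uE2 mul0mx mulmx0 add0r mulmxN subrr.
rewrite mulmxDr uH_tcol0r uH_tcol1r Ha HE mulmx0 add0r; congr (_ + _).
by rewrite -scalemxAr scaler_nat mulr2n addrK.
Qed.

(** Write u = v_0 (x) a + v_1 (x) b. Weight 1 forces weights 0 and 2 on a and b, so K b = -b, and
    the v_0 component of E u = 0 reads E a + K b = 0. *)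
Lemma hw_liftE (u : 'cV[C]_(2 * d)) : @hw_vector R VU u ->
  uH U *m ((c0 d)^T *m u) = 0 /\ u = hw_lift *m ((c0 d)^T *m u).
Proof.
move=> [Eu Hu]; set a := _ *m u.
pose b := (c1 d)^T *m u.
have udec : u = c0 d *m a + c1 d *m b.
  by have := sum_tcol C 2 d; rewrite big_ord2 !mulmxA -mulmxDl => ->; rewrite mul1mx.
have proj x y x' y' :
    c0 d *m x + c1 d *m y = c0 d *m x' + c1 d *m y' :> 'cV[C]_(2 * d) -> x = x' /\ y = y'.
  move=> e; split.
    by move/(congr1 (mulmx (c0 d)^T)): e; rewrite !mulmxDr !tr_tcol00r !tr_tcol01r !addr0.
  by move/(congr1 (mulmx (c1 d)^T)): e; rewrite !mulmxDr !tr_tcol10r !tr_tcol11r !add0r.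
move: Eu Hu; rewrite udec !mulmxDr uE_tcol0r uE_tcol1r uH_tcol0r uH_tcol1r => Eu Hu.
have [Eab _] : uE U *m a + uK U *m b = 0 /\ uE U *m b = 0.
  by apply: proj; rewrite !mulmx0 addr0 mulmxDr -[RHS]Eu addrAC -!addrA.
have [Ha Hb] : uH U *m a + a = a /\ uH U *m b - b = b.
  by apply: proj; rewrite mulmxDr mulmxBr.
have {}Ha : uH U *m a = 0 by apply: (addIr a); rewrite add0r.
have {}Hb : uH U *m b = 2%:R *: b by rewrite scaler_nat mulr2n; apply/eqP; rewrite -subr_eq Hb.
have := uK_qH Hb; rewrite qpow2 scaleN1r => Kb.
split=> //; rewrite /hw_lift mulmxDl -mulmxA; congr (_ + _ *m _).
by apply/esym/eqP; rewrite -subr_eq0 -Kb; apply/eqP.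
Qed.
End Lift.

(** The number of factors v_1 in the basis vector of index k. *)
Fixpoint ones m : 'I_(udim (upow V m)) -> nat :=
  match m return 'I_(udim (upow V m)) -> nat with
  | 0 => fun _ => 0%N
  | m'.+1 => fun k => ((mxtens_unindex k).1 + ones (mxtens_unindex k).2)%N
  end.

Lemma ones_index m (i : 'I_2) k : @ones m.+1 (mxtens_index (i, k)) = (i + @ones m k)%N.
Proof.
rewrite -[LHS]/((mxtens_unindex (mxtens_index (i, k))).1 +
  @ones m (mxtens_unindex (mxtens_index (i, k))).2)%N.
by rewrite mxtens_indexK.
Qed.

(** Pascal's rule, splitting on whether the first factor is v_0 or v_1. *)
Lemma card_ones m j : #|[set k | @ones m k == j]| = 'C(m, j).
Proof.
elim: m j => [|m IH] j.
  case: j => [|j]; rewrite ?bin0 ?bin0n /=.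
    by rewrite -[RHS](card_ord 1); apply: eq_card => k; rewrite !inE.
  by apply: eq_card0 => k; rewrite !inE.
rewrite -sum1_card big_mkcond (reindex (@mxtens_index 2 (udim (upow V m)))); last first.
  by exists (@mxtens_unindex _ _) => k _; rewrite (mxtens_indexK, mxtens_unindexK).
transitivity (\sum_(p : 'I_2 * 'I_(udim (upow V m))) (p.1 + @ones m p.2 == j))%N.
  by apply: eq_bigr => -[i k] _; rewrite inE ones_index; case: eqP.
rewrite -(pair_bigA _ (fun i k => nat_of_bool (nat_of_ord i + @ones m k == j)%N)) /=.
rewrite big_ord_recl big_ord1.
have e i : (\sum_k (i + @ones m k == j) = #|[set k | (i + @ones m k == j)]|)%N.
  by rewrite -sum1_card [RHS]big_mkcond; apply: eq_bigr => k _; rewrite inE; case: eqP.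
rewrite !e; case: j {e} => [|j].
  by rewrite IH !bin0 eq_card0 ?addn0 // => k; rewrite !inE.
rewrite binS -!IH; congr (_ + _)%N; apply: eq_card => k; by rewrite !inE.
Qed.

Lemma uH_upow m : uH (upow V m) = diag_mx (\row_k (m%:R - (@ones m k).*2%:R)).
Proof.
elim: m => [|m IH].
  by apply/matrixP => i j; rewrite !mxE subrr mul0rn.
rewrite [uH _]/= -/(upow V m) IH; apply/matrixP => x y.
case: (mxtens_indexP x) => i k; case: (mxtens_indexP y) => j l {x y}.
rewrite mxE !tensmxE [in RHS]mxE [in RHS]mxE (can_eq (@mxtens_indexK _ _)) xpair_eqE.
rewrite ones_index !mxE.
case: (i == j); case: (k == l);
  rewrite ?mulr0n ?mulr1n ?mulr0 ?mul0r ?mulr1 ?mul1r ?addr0 //.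
case: i => [[|[|//]] ?] /=; rewrite ?expr0 ?expr1.
  by rewrite add0n addrA -natr1 [1 + _]addrC.
by rewrite add1n doubleS -addn2 natrD -natr1; ring.
Qed.

Lemma uH_upow_eq0 n (a : 'cV[C]_(udim (upow V (2 * n)))) :
  uH (upow V (2 * n)) *m a = 0 <-> forall k, @ones (2 * n) k != n -> a k 0 = 0.
Proof.
rewrite uH_upow mul_diag_mx; split=> [/matrixP Ha k nk|Ha].
  have := Ha k 0; rewrite !mxE => /eqP; rewrite mulf_eq0 subr_eq0 -mul2n eqr_nat.
  by rewrite eqn_pmul2l // eq_sym (negPf nk) => /eqP.
apply/matrixP => k j; rewrite !mxE ord1; case: (eqVneq (@ones (2 * n) k) n) => [->|/Ha->].
  by rewrite -mul2n subrr mul0r.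
by rewrite mulr0.
Qed.

Lemma dim_uhom n : \dim (uhom V (upow V (2 * n + 1))) = 'C(2 * n, n).
Proof.
rewrite addn1 -card_ones; set U := upow V (2 * n).
set S := [set k | _].
(* The columns of [B] are the basis vectors with exactly n factors v_1, a basis of the weight 0
   subspace. *)
pose B : 'M[C]_(udim U, #|S|) := \matrix_(k, i) (k == enum_val i)%:R.
have BE (c : 'cV[C]_#|S|) i : (B *m c) (enum_val i) 0 = c i 0.
  rewrite mxE (bigD1 i) //= mxE eqxx mul1r big1 ?addr0 // => j nji.
  by rewrite mxE (inj_eq enum_val_inj) eq_sym (negPf nji) mul0r.
have HB (c : 'cV[C]_#|S|) : uH U *m (B *m c) = 0.
  apply/uH_upow_eq0 => k nk; rewrite mxE big1 // => i _; rewrite mxE.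
  case: eqP => [ki|_]; last by rewrite mul0r.
  by have := enum_valP i; rewrite -ki inE (negPf nk).
have BH (a : 'cV[C]_(udim U)) : uH U *m a = 0 -> exists c, a = B *m c.
  move=> /uH_upow_eq0 a0; exists (\col_i a (enum_val i) 0).
  apply/matrixP => k j; rewrite ord1; case: (boolP (k \in S)) => kS.
    by rewrite -(enum_rankK_in kS kS) BE mxE.
  rewrite a0; last by move: kS; rewrite inE.
  rewrite mxE big1 // => i _; rewrite mxE; case: eqP => [ki|_]; last by rewrite mul0r.
  by rewrite ki enum_valP in kS.
pose W := utens V U.
pose P := (mulmx (hw_lift U *m B)).
(* [f] sends weight 0 coordinates c to the morphism whose highest weight vector is the lift of B c.
   It is shown to be injective with image the whole space of morphisms. *)
pose f : 'Hom('cV[C]_#|S|, 'M[C]_(udim W, 2)) :=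
  linfun (mulmxr (delta_mx (0 : 'I_1) (0 : 'I_2)) \o mulmx (hw_lift U *m B)) +
  linfun (mulmxr (delta_mx (0 : 'I_1) (1 : 'I_2)) \o mulmx (uF W *m (hw_lift U *m B))).
have fE c : f c = @hw_hom R W (hw_lift U *m (B *m c)).
  by rewrite add_lfunE !lfunE /= /hw_hom !mulmxA.
have finj : (lker f == 0)%VS.
  rewrite -subv0; apply/subvP => c; rewrite memv_ker fE memv0 => /eqP fc0.
  have := hw_hom0 (hw_lift U *m (B *m c) : 'cV_(udim W)).
  rewrite fc0 mul0mx => /esym /(congr1 (mulmx (tcol C (udim U) (0 : 'I_2))^T)).
  rewrite mulmx0 {1}/hw_lift mulmxDl -mulmxA mulmxDr tr_tcol00r tr_tcol01r addr0 => Bc0.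
  by apply/eqP/matrixP => i j; rewrite ord1 -BE Bc0 !mxE.
suff -> : uhom V (upow V (2 * n).+1) = limg f.
  rewrite limg_dim_eq; last by apply/eqP; rewrite (eqP finj) capv0.
  by rewrite dimvf /= dim_matrix; exact: muln1.
apply/vspaceP => g; apply/idP/idP => [/hw_of_hom[/hw_liftE[Ha gE] ->]|].
  have [c aE] := BH _ Ha.
  by apply/memv_imgP; exists c; rewrite ?memvf // fE -aE -gE.
move=> /memv_imgP[c _ ->]; rewrite fE; apply: (@hw_hom_in R W).
exact: hw_lift_vector.
Qed.
End Dimension.

(** * Non-degenerate Hermitian forms with an isotropic vector *)

Section MixedSignature.
Variables (C : numClosedFieldType) (U : vectType C).
Variable h : {hermitian_sym U for (@Num.conj C)}.

Lemma herm_conj u v : h u v = (h v u)^*.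
Proof. by rewrite hermC expr0 mul1r. Qed.

Lemma herm_sumE I (r : seq I) (a b : I -> C) (e : I -> U) :
  h (\sum_(i <- r) a i *: e i) (\sum_(j <- r) b j *: e j) =
  \sum_(i <- r) \sum_(j <- r) a i * (b j)^* * h (e i) (e j).
Proof.
rewrite linear_sumlz; apply: eq_bigr => i _; rewrite linear_sumr; apply: eq_bigr => j _.
by rewrite linearZlr /= mulrA.
Qed.

(** The Gram matrix G of a basis is Hermitian, so the spectral theorem gives a unitary P with P G
    P^* diagonal; the rows of P are the coordinates of the new basis. *)
Lemma orthogonal_basis_exists : exists2 e : (\dim {:U}).-tuple U, basis_of fullv e &
  forall i j, i != j -> h (tnth e i) (tnth e j) = 0.
Proof.
set d := \dim {:U}.
pose b i := tnth (vbasis {:U}) i.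
pose G := \matrix_(i < d, j < d) h (b i) (b j).
have Gherm : G \is hermsymmx.
  apply/is_hermitianmxP; rewrite expr0 scale1r.
  by apply/matrixP => i j; rewrite !mxE -herm_conj.
have Gn := hermitian_normalmx Gherm.
have /orthomx_spectralP := Gn; set P := spectralmx G; set D := spectral_diag G => GE.
have uP : P \in unitmx := spectral_unit G.
have PGP : P *m G *m map_mx Num.conj P^T = diag_mx D.
  rewrite GE -(invmx_unitary (spectral_unitarymx G)) -/P !mulmxA mulmxV //.
  by rewrite mul1mx mulmxK.
pose e := [tuple \sum_j P i j *: b j | i < d].
have eE i : tnth e i = \sum_j P i j *: b j by rewrite tnth_mktuple.
exists e; last first.
  move=> i k nik; rewrite !eE herm_sumE exchange_big /=.
  transitivity ((P *m G *m map_mx Num.conj P^T) i k); last by rewrite PGP mxE (negPf nik).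
  rewrite [RHS]mxE; apply: eq_bigr => l _; rewrite mxE mulr_suml; apply: eq_bigr => j _.
  by rewrite !mxE mulrAC.
(* The tuple has as many vectors as the dimension, so spanning is enough; the old basis is recovered
   through P^-1. *)
rewrite basisEdim size_tuple leqnn andbT.
rewrite -(span_basis (vbasisP fullv)); apply/span_subvP => _ /tnthP[j ->].
rewrite -/(b j).
have -> : b j = \sum_i invmx P j i *: tnth e i.
  under eq_bigr => i _ do rewrite eE scaler_sumr.
  rewrite exchange_big /=; transitivity (\sum_k (invmx P *m P) j k *: b k).
    rewrite mulVmx // (bigD1 j) //= big1 => [|k nkj]; rewrite mxE.
      by rewrite eqxx scale1r addr0.
    by rewrite eq_sym (negPf nkj) scale0r.
  apply: eq_bigr => k _; rewrite mxE scaler_suml; apply: eq_bigr => i _.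
  by rewrite scalerA.
by apply: memv_suml => i _; apply: memvZ; apply: memv_span; apply: mem_tnth.
Qed.

(** In an orthogonal basis h u u = 0 becomes sum |a_i|^2 d_i = 0 with all d_i real and non-zero. If
    the d_i had one sign, every a_i would vanish. *)
Lemma isotropic_mixed_signature u :
  nondegenerate h -> u != 0 -> h u u = 0 -> mixed_signature h.
Proof.
move=> nd u0 huu; have [e be oe] := orthogonal_basis_exists.
pose d i := h (tnth e i) (tnth e i).
have dreal i : d i \is Num.real by apply/CrealP; rewrite /d [RHS]herm_conj.
pose a i := coord e i u.
have uE : u = \sum_i a i *: tnth e i.
  rewrite [LHS](coord_basis be (memvf u)); apply: eq_bigr => i _.
  by rewrite (tnth_nth 0).
have sum0 : \sum_i `|a i| ^+ 2 * d i = 0.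
  transitivity (h u u); last exact: huu.
  rewrite [in RHS]uE herm_sumE; apply: eq_bigr => i _.
  rewrite (bigD1 i) //= big1 ?addr0 ?normCK // => j nij.
  by rewrite oe ?mulr0 // eq_sym.
have d0 i : d i != 0.
  apply/eqP => di0; have : tnth e i != 0.
    by apply: (free_not0 (basis_free be)); apply: mem_tnth.
  case/negP; rewrite -memv0 -(eqP nd); apply/mem_orthovP => v _.
  rewrite (coord_basis be (memvf v)) linear_sumr big1 // => j _.
  rewrite -tnth_nth linearZr /=; case: (eqVneq i j) => [<-|nij].
    by rewrite -/(d i) di0 mulr0.
  by rewrite oe ?mulr0.
(* Used with s = 1 and s = -1, to obtain a positive and a negative d_i by the same argument. *)
have definite (s : C) : s \is Num.real -> s != 0 -> ~~ [exists i, 0 < s * d i] -> False.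
  move=> sr s0; rewrite negb_exists => /forallP nd'.
  have le0 i : s * d i < 0.
    by rewrite real_ltNge ?real0 ?realM // le_eqVlt eq_sym mulf_eq0 (negPf s0) (negPf (d0 i)) nd'.
  have : \sum_i `|a i| ^+ 2 * (- (s * d i)) = 0.
    under eq_bigr => i _ do rewrite mulrN mulrCA -mulrN.
    by rewrite -mulr_sumr sumrN sum0 oppr0 mulr0.
  move/eqP; rewrite psumr_eq0 => [/allP a0|i _]; last first.
    by rewrite mulr_ge0 ?exprn_ge0 ?normr_ge0 // oppr_ge0 ltW.
  case/negP: u0; rewrite uE big1 // => i _.
  have := a0 i (mem_index_enum _); rewrite /= mulf_eq0 oppr_eq0 (lt_eqF (le0 i)) orbF.
  by rewrite expf_eq0 normr_eq0 => /= /eqP->; rewrite scale0r.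
exists #|[set i | 0 < d i]|, #|[set i | d i < 0]|; split; first by exists e.
- apply/card_gt0P; suff [i di] : exists i, 0 < 1 * d i by exists i; rewrite inE -[d i]mul1r.
  apply/existsP; apply: contraT => ne.
  by case: (definite _ _ _ ne); rewrite ?real1 ?oner_eq0.
- apply/card_gt0P; suff [i di] : exists i, 0 < -1 * d i.
    by exists i; rewrite inE -oppr_gt0 -mulN1r.
  apply/existsP; apply: contraT => ne.
  by case: (definite _ _ _ ne); rewrite ?realN ?real1 ?oppr_eq0 ?oner_eq0.
Qed.
End MixedSignature.

(** * The braid group action and the invariant form on the space of morphisms *)

Section Action.
Variables (R : realType) (n : nat).
Local Notation C := R[i].
Local Notation V := (V0 R).
Local Notation m := (2 * n + 1)%N.
Local Notation H := (Hspace R n).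
Local Notation homs := (uhom V (upow V m)).

Lemma word_mx_uhom (w : braid_word m) (f : 'M[C]_(udim (upow V m), 2)) :
  f \in homs -> word_mx R w *m f \in homs.
Proof.
elim: w => [|x w IH] fH; first by rewrite mul1mx.
rewrite -[word_mx _ _]/(letter_mx R x *m word_mx R w) -mulmxA.
move: (word_mx R w *m f) (IH fH) => g /uhomP[gE gF gK gH].
have [tE tF tK tH] := tl_comm R m x.1.
have comm (A : 'M[C]_(udim (upow V m))) B : A *m tl_mx R m x.1 = tl_mx R m x.1 *m A -> A *m g = g *m B ->
    A *m (letter_mx R x *m g) = letter_mx R x *m g *m B.
  move=> At Ag; rewrite -mulmxA -Ag !mulmxA; congr (_ *m _).
  by rewrite /letter_mx; case: x.2; rewrite -scalemxAr -scalemxAl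
    ?mulmxDr ?mulmxDl ?mulmxN ?mulNmx At mulmx1 mul1mx.
by apply/uhomP; split; apply: comm.
Qed.

(** Uses a chosen word for each braid; by [braid_eq_mx] the choice does not matter, and by
    [word_mx_uhom] the projection back to morphisms changes nothing. *)
Definition braid_action (b : braid_group m) : 'End(H) :=
  linfun (vsproj homs \o mulmx (word_mx R (braid_repr b)) \o vsval).

Lemma braid_actionE b (f : H) :
  vsval (braid_action b f) = word_mx R (braid_repr b) *m vsval f.
Proof. by rewrite lfunE /= vsprojK // word_mx_uhom // subvsP. Qed.

Lemma braid_action_of w (f : H) : vsval (braid_action (braid_of w) f) = word_mx R w *m vsval f.
Proof. by rewrite braid_actionE (braid_eq_mx R (braid_reprP w)). Qed.

Lemma braid_actionP : is_braid_action braid_action.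
Proof.
split.
- apply/lfunP => f; apply: subvs_inj.
  by rewrite -[1%g]/(braid_of [::]) braid_action_of mul1mx id_lfunE.
- move=> a b; apply/lfunP => f; apply: subvs_inj.
  by rewrite braid_action_of word_mx_cat comp_lfunE !braid_actionE mulmxA.
- move=> i f; rewrite braid_action_of /= mulmx1 /letter_mx /= braiding_atE //.
  by rewrite -ltn_predRL.
Qed.

Definition hom_form (f g : H) : C := hform (vsval f) (vsval g).

Lemma hom_form_linearl g : scalar (hom_form ^~ g).
Proof.
move=> a f f'; rewrite /hom_form (_ : vsval _ = a *: vsval f + vsval f'); last exact: linearP.
by rewrite /hform mulmxDr -scalemxAr [LHS]mxE; congr (_ + _); rewrite mxE.
Qed.

Lemma hom_formC f g : hom_form f g = (hom_form g f)^*.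
Proof. exact: hform_herm (subvsP f) (subvsP g). Qed.

Lemma hom_form_linearr f : linear_for (Num.conj \; *%R) (hom_form f).
Proof.
by move=> a g g'; rewrite !(hom_formC f) hom_form_linearl rmorphD rmorphM.
Qed.

HB.instance Definition _ := bilinear_isBilinear.Build C H H C *%R (Num.conj \; *%R)
  hom_form (hom_form_linearl, hom_form_linearr).
HB.instance Definition _ := isHermitianSesquilinear.Build C H false Num.conj hom_form
  (fun f g => etrans (hom_formC f g) (esym (mul1r _))).

Lemma hom_form_nondegenerate : nondegenerate (hom_form : {hermitian_sym H for (@Num.conj C)}).
Proof.
rewrite /nondegenerate -subv0; apply/subvP => f /mem_orthovP f0; rewrite memv0.
apply/eqP/subvs_inj/hform_nondeg; first exact: subvsP.
move=> g gH; have := f0 (vsproj homs g) (memvf _).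
rewrite /= hom_formC => /eqP; rewrite conjC_eq0 => /eqP.
by rewrite /hom_form vsprojK.
Qed.

End Action.

Theorem theorem21 (R : realType) (n : nat) (n_ge1 : (1 <= n)%N) :
  (exists rho : braid_group (2 * n + 1) -> 'End(Hspace R n),
    is_braid_action rho /\
    exists h : {hermitian_sym Hspace R n for (@Num.conj R[i])},
      [/\ nondegenerate h, mixed_signature h
        & forall b f g, h (rho b f) (rho b g) = h f g]) /\
  \dim {: Hspace R n} = 'C(2 * n, n).
Proof.
split; last by rewrite dimvf; exact: dim_uhom.
exists (@braid_action R n); split; first exact: braid_actionP.
exists (hom_form (n := n)); split; first exact: hom_form_nondegenerate.
(* As n >= 1 there are at least three tensor factors, enough for one copy of b in front of a highest
   weight vector. *)
- have [u [u0 hu iso]] : isotropic_hw R (2 * n + 1).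
    by rewrite addn1 mul2n -(prednK n_ge1); apply: isotropic_exists.
  have uH := hw_hom_in hu.
  apply: (@isotropic_mixed_signature _ _ _ (vsproj _ (hw_hom u)) (@hom_form_nondegenerate R n)).
    apply: contra_neq u0 => /(congr1 vsval); rewrite vsprojK // linear0 => fu0.
    by rewrite -(hw_hom0 u) fu0 mul0mx.
  by rewrite /= /hom_form vsprojK // hform_col hw_hom0 hw_hom1 iso mxE.
- move=> b f g; rewrite /= /hom_form !braid_actionE.
  exact: hform_unitary.
Qed.
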